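(* Let $n \in \mathbb{N}$, $n \geq 3$, and let $\mathcal{J}_{n}$ be the Jones monoid of degree $n$. Then the maximal subsemigroups of $\mathcal{J}_{n}$ are precisely: (a) $\mathcal{J}_{n} \setminus \{ \mathrm{id}_{n} \}$ (type (M1)); (b) the union of $\{\alpha\in\mathcal{J}_{n} : \operatorname{rank}(\alpha)\neq n - 2\}$ and the union of the Green's classes contained in a maximal independent subset of $\Delta(\mathcal{J}_{n})$ that is not a bicomponent of $\Delta(\mathcal{J}_{n})$ (type (M2)); (c) $\mathcal{J}_{n} \setminus L$, where $L$ is any $\mathscr{L}$-class in $\mathcal{J}_{n}$ of rank $n - 2$ (type (M3)); and (d) $\mathcal{J}_{n} \setminus R$, where $R$ is any $\mathscr{R}$-class in $\mathcal{J}_{n}$ of rank $n - 2$ (type (M4)). In particular, for $n \geq 3$, there are $2F_{n - 1} + 2n - 3$ maximal subsemigroups of $\mathcal{J}_{n}$, where $F_{n - 1}$ is the $(n - 1)$th term of the Fibonacci sequence, defined by $F_{1} = F_{2} = 1$ and $F_{k} = F_{k - 1} + F_{k - 2}$ for $k \geq 3$. The Jones monoid $\mathcal{J}_{2}$ is a semilattice of order $2$: its maximal subsemigroups are each of its singleton subsets.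
   Context: $\mathbb{N}=\{1,2,3,\ldots\}$. A maximal subsemigroup of a semigroup $S$ is a proper subsemigroup not contained in any other proper subsemigroup. A semilattice is a commutative semigroup of idempotents. A partition of degree $n$ is an equivalence relation on $\{1,\ldots,n\}\cup\{1',\ldots,n'\}$; its classes are called blocks; a block is transverse if it contains both unprimed and primed points. The rank of a partition is its number of transverse blocks. The product $\alpha\beta$: replace each $i'$ by $i''$ in $\alpha$ to get $\alpha'$, replace each $i$ by $i''$ in $\beta$ to get $\beta'$; let $(\alpha\beta)'$ be the smallest equivalence on $\{1,\ldots,n\}\cup\{1',\ldots,n'\}\cup\{1'',\ldots,n''\}$ containing $\alpha'\cup\beta'$; then $\alpha\beta$ is the restriction of $(\alpha\beta)'$ to $\{1,\ldots,n\}\cup\{1',\ldots,n'\}$. The identity $\mathrm{id}_n$ has blocks $\{i,i'\}$. Order the points by $n'<(n-1)'<\cdots<1'<1<2<\cdots<n$; $\alpha$ is planar if there do not exist distinct blocks $A,X$ of $\alpha$ and points $a,b\in A$, $x,y\in X$ with $a<x<b<y$. $\mathcal{J}_n$ is the monoid of planar partitions of degree $n$ all of whose blocks have size exactly $2$. For $i\in\{1,\ldots,n-1\}$ let $R_i=\{\alpha\in\mathcal{J}_n:\operatorname{rank}(\alpha)=n-2,\ \{i,i+1\}\text{ is a block of }\alpha\}$ and $L_i=\{\alpha\in\mathcal{J}_n:\operatorname{rank}(\alpha)=n-2,\ \{i',(i+1)'\}\text{ is a block of }\alpha\}$; these are the $\mathscr{R}$-classes and $\mathscr{L}$-classes, respectively,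 of rank $n-2$. $\Delta(\mathcal{J}_n)$ is the bipartite graph whose $2n-2$ vertices are $\{L_1\},\ldots,\{L_{n-1}\},\{R_1\},\ldots,\{R_{n-1}\}$, with $\{L_i\}$ and $\{R_j\}$ adjacent if and only if $L_i\cap R_j$ is a group, equivalently $|i-j|\le 1$, and no other edges. Its bicomponents are the set of all vertices $\{L_i\}$ and the set of all vertices $\{R_i\}$. A maximal independent subset is a set of pairwise non-adjacent vertices contained in no other such set. Types: a maximal subsemigroup $M$ of a finite monoid $S$ arises from the $\mathscr{J}$-class $J$ if $S\setminus M\subseteq J$; when $J$ is regular, $M$ has type (M1) if $M\cap J=\varnothing$; (M2) if $M\cap J$ is a non-empty union of both $\mathscr{L}$- and $\mathscr{R}$-classes of $J$ (those in a non-empty proper subset of the $\mathscr{L}$-classes together with those in a non-empty proper subset of the $\mathscr{R}$-classes); (M3) if $M\cap J$ is a non-empty union of $\mathscr{L}$-classes; (M4) if $M\cap J$ is a non-empty union of $\mathscr{R}$-classes; (M5) if $M\cap J$ meets every $\mathscr{H}$-class of $J$. *)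

(* Defs.v *)
From HB Require Import structures.
From mathcomp Require Import all_boot.

Set Implicit Arguments.
Unset Strict Implicit.
Unset Printing Implicit Defensive.

(** A semigroup is given by an ambient finite type [T], an operation [mul] on
    [T] and a subset [S : {set T}] closed under [mul]. *)

Section FiniteSemigroups.
Context (T : finType) (mul : T -> T -> T).
Implicit Types (S M J G L R : {set T}) (a b e : T).

Definition mul_closed M : bool :=
  [forall a in M, forall b in M, mul a b \in M].

Definition mul_assoc M : bool :=
  [forall a in M, forall b in M, forall c in M,
     mul a (mul b c) == mul (mul a b) c].

Definition subsemigroup M : bool := (M != set0) && mul_closed M.

Definition proper_subsemigroup S M : bool := (M \proper S) && subsemigroup M.

Definition maximal_subsemigroup S M : bool := maxset (proper_subsemigroup S) M.

Definition semilattice S : bool :=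
  [&& subsemigroup S, mul_assoc S,
      [forall a in S, forall b in S, mul a b == mul b a]
    & [forall a in S, mul a a == a]].

Definition is_group G : bool :=
  [&& mul_closed G, mul_assoc G &
      [exists e in G, forall a in G,
         [&& mul e a == a, mul a e == a
           & [exists b in G, (mul a b == e) && (mul b a == e)]]]].

(* The principal ideals S^1 a, a S^1 and S^1 a S^1. *)
Definition left_ideal S a : {set T} := a |: [set mul s a | s in S].
Definition right_ideal S a : {set T} := a |: [set mul a s | s in S].
Definition two_sided_ideal S a : {set T} :=
  left_ideal S a :|: \bigcup_(s in S) left_ideal S (mul a s).

Definition greenL S : rel T := fun a b => left_ideal S a == left_ideal S b.
Definition greenR S : rel T := fun a b => right_ideal S a == right_ideal S b.
Definition greenJ S : rel T :=
  fun a b => two_sided_ideal S a == two_sided_ideal S b.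

Definition L_classes S : {set {set T}} := equivalence_partition (greenL S) S.
Definition R_classes S : {set {set T}} := equivalence_partition (greenR S) S.
Definition J_classes S : {set {set T}} := equivalence_partition (greenJ S) S.

Definition L_classes_in S J : {set {set T}} := [set L in L_classes S | L \subset J].
Definition R_classes_in S J : {set {set T}} := [set R in R_classes S | R \subset J].

Definition regular S J : bool :=
  [forall a in J, exists x in S, mul (mul a x) a == a].

Definition arises_from_regular S M J : Prop :=
  [/\ J \in J_classes S, S :\: M \subset J & regular S J].

Definition type_M1 S M : Prop :=
  exists J, arises_from_regular S M J /\ M :&: J = set0.

Definition type_M2 S M : Prop :=
  exists J, arises_from_regular S M J /\ M :&: J != set0 /\
  exists A B : {set {set T}},
    [/\ A != set0, A \proper L_classes_in S J,
        B != set0, B \proper R_classes_in S J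
      & M :&: J = cover A :|: cover B].

Definition type_M3 S M : Prop :=
  exists J, arises_from_regular S M J /\ M :&: J != set0 /\
  exists2 A : {set {set T}}, A \subset L_classes_in S J & M :&: J = cover A.

Definition type_M4 S M : Prop :=
  exists J, arises_from_regular S M J /\ M :&: J != set0 /\
  exists2 B : {set {set T}}, B \subset R_classes_in S J & M :&: J = cover B.

End FiniteSemigroups.

Section Graphs.
Context (V : finType) (adj : rel V).

Definition independent (I : {set V}) : bool :=
  [forall u in I, forall v in I, ~~ adj u v].

Definition maximal_independent (I : {set V}) : bool := maxset independent I.

End Graphs.

(** [inl i] is the unprimed point i+1 and [inr i] the primed point (i+1)'. *)

Notation point n := ('I_n + 'I_n)%type.

Record dpart (n : nat) := DPart {
  blocks : {set {set point n}};
  blocksP : partition blocks [set: point n] }.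

HB.instance Definition _ n := [isSub for @blocks n].
HB.instance Definition _ n := [Countable of dpart n by <:].
HB.instance Definition _ n := [Finite of dpart n by <:].

Section Partitions.
Variable n : nat.
Implicit Types (al be : dpart n) (x y : point n).

Definition same_block al : rel (point n) := fun x y => y \in pblock (blocks al) x.

Definition transverse (A : {set point n}) : bool :=
  [exists i, inl i \in A] && [exists i, inr i \in A].

Definition rank al : nat := #|[set A in blocks al | transverse A]|.

(* The unprimed, primed and double-primed points, in this order. *)
Definition point3 : finType := ('I_n + 'I_n + 'I_n)%type.

(* Replacing i' by i'', resp. i by i''. *)
Definition prime_to_middle x : point3 :=
  match x with inl i => inl (inl i) | inr i => inr i end.
Definition unprimed_to_middle x : point3 :=
  match x with inl i => inr i | inr i => inl (inr i) end.

Definition glue al be : rel point3 := fun u v =>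
  [exists x, exists y, [&& u == prime_to_middle x, v == prime_to_middle y
                         & same_block al x y]]
  || [exists x, exists y, [&& u == unprimed_to_middle x,
                              v == unprimed_to_middle y & same_block be x y]].

(* [glue al be] is symmetric, so its reflexive transitive closure is the
   smallest equivalence containing it: see [glue_closure_equiv] and
   [glue_closure_min]. *)
Definition glue_closure al be : rel point3 := connect (glue al be).

Lemma same_block_sym al : symmetric (same_block al).
Proof.
have /and3P [/eqP covP tiP _] := blocksP al.
have covx z : z \in cover (blocks al) by rewrite covP inE.
by move=> x y; rewrite /same_block -!eq_pblock // eq_sym.
Qed.

Lemma glue_sym al be : symmetric (glue al be).
Proof.
suff sub u v : glue al be u v -> glue al be v u.
  by move=> u v; apply/idP/idP; apply: sub.
case/orP=> /existsP [x /existsP [y /and3P [ux vy sxy]]];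
  apply/orP; [left | right]; apply/existsP; exists y; apply/existsP; exists x;
  by rewrite ux vy same_block_sym.
Qed.

Lemma glue_closure_equiv al be : equivalence_rel (glue_closure al be).
Proof.
apply/equivalence_relP; split; first exact: connect0.
by move=> u v uv w; apply: same_connect uv w; apply: sym_connect_sym; apply: glue_sym.
Qed.

Lemma glue_closure_min al be (e : rel point3) :
  equivalence_rel e -> subrel (glue al be) e -> subrel (glue_closure al be) e.
Proof.
move=> /equivalence_relP [e_refl e_ltr] sub u v /connectP [p pth ->].
elim: p u pth => [|w p IHp] u //= /andP [uw pth].
by rewrite (e_ltr _ _ (sub _ _ uw)); apply: IHp.
Qed.

Definition prod_rel al be : rel (point n) :=
  fun x y => glue_closure al be (inl x) (inl y).

Lemma prod_subproof al be :
  partition (equivalence_partition (prod_rel al be) [set: point n]) [set: point n].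
Proof.
apply: equivalence_partitionP => x y z _ _ _; exact: glue_closure_equiv.
Qed.

Definition dmul al be : dpart n := DPart (prod_subproof al be).

Lemma id_subproof :
  partition [set [set inl i; inr i] | i : 'I_n] [set: point n].
Proof.
pose f (x : point n) : 'I_n := match x with inl i => i | inr i => i end.
have -> : [set [set inl i; inr i] | i : 'I_n] = preim_partition f [set: point n].
  have E i x : (x \in [set inl i; inr i]) = (i == f x).
    by case: x => j; rewrite !inE ?orbF [RHS]eq_sym.
  apply/setP => A; apply/imsetP/imsetP => [[i _ ->] | [x _ ->]].
    by exists (inl i) => //; apply/setP => x; rewrite E !inE.
  by exists (f x) => //; apply/setP => y; rewrite E !inE.
exact: preim_partitionP.
Qed.

Definition did : dpart n := DPart id_subproof.

(* Position in the ordering n' < ... < 1' < 1 < ... < n. *)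
Definition pos x : nat :=
  match x with inl i => n + i | inr i => n.-1 - i end.

Definition planar al : bool :=
  ~~ [exists A in blocks al, exists X in blocks al,
        (A != X) &&
        [exists a in A, exists b in A, exists x in X, exists y in X,
           [&& pos a < pos x, pos x < pos b & pos b < pos y]]].

Definition Jones : {set dpart n} :=
  [set al | planar al && [forall A in blocks al, #|A| == 2]].

(* For [i : 'I_n.-1] standing for i+1 in {1, ..., n-1}, the indices of the
   points i+1 and i+2. *)
Lemma hi_subproof (i : 'I_n.-1) : i.+1 < n.
Proof. by rewrite -ltn_predRL. Qed.

Definition lo (i : 'I_n.-1) : 'I_n := widen_ord (leq_pred n) i.
Definition hi (i : 'I_n.-1) : 'I_n := Ordinal (hi_subproof i).

Definition Rcl (i : 'I_n.-1) : {set dpart n} :=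
  [set al in Jones | (rank al == n - 2)
                     && ([set inl (lo i); inl (hi i)] \in blocks al)].
Definition Lcl (i : 'I_n.-1) : {set dpart n} :=
  [set al in Jones | (rank al == n - 2)
                     && ([set inr (lo i); inr (hi i)] \in blocks al)].

(* The graph Delta(J_n): [inl i] is the vertex {L_i}, [inr j] the vertex {R_j}. *)
Definition vertex : finType := ('I_n.-1 + 'I_n.-1)%type.

Definition vclass (v : vertex) : {set dpart n} :=
  match v with inl i => Lcl i | inr j => Rcl j end.

Definition Delta : rel vertex := fun u v =>
  match u, v with
  | inl i, inr j => is_group dmul (Lcl i :&: Rcl j)
  | inr j, inl i => is_group dmul (Lcl i :&: Rcl j)
  | _, _ => false
  end.

Definition bicomponent (I : {set vertex}) : bool :=
  (I == [set inl i | i : 'I_n.-1]) || (I == [set inr j | j : 'I_n.-1]).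

Definition has_rank (C : {set dpart n}) (r : nat) : bool :=
  [forall al in C, rank al == r].

Definition family_a (M : {set dpart n}) : Prop := M = Jones :\ did.

Definition family_b (M : {set dpart n}) : Prop :=
  exists I : {set vertex},
    [/\ maximal_independent Delta I, ~~ bicomponent I
      & M = [set al in Jones | rank al != n - 2] :|: \bigcup_(v in I) vclass v].

Definition family_c (M : {set dpart n}) : Prop :=
  exists L, [/\ L \in L_classes dmul Jones, has_rank L (n - 2) & M = Jones :\: L].

Definition family_d (M : {set dpart n}) : Prop :=
  exists R, [/\ R \in R_classes dmul Jones, has_rank R (n - 2) & M = Jones :\: R].

End Partitions.

Arguments Jones n : clear implicits.
Arguments dmul {n} al be.

Fixpoint fib (k : nat) : nat :=
  match k with
  | 0 => 0
  | 1 => 1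
  | (k'.+1 as k1).+1 => fib k1 + fib k'
  end.

(* Main.v *)
Require Import Defs.
From mathcomp Require Import all_boot.
From mathcomp Require Import zify.

(** The Jones monoid of degree [n >= 3] has three layers: the identity, the elements of rank
    [n - 2], and the ideal of elements of smaller rank. An element of rank
    [n - 2] is determined by the position [i] of its only block inside the
    unprimed row and the position [j] of its only block inside the primed row; call it
    [el i j]. The product [el i j * el k l] is [el i l] when [|j - k| <= 1] and
    has smaller rank otherwise ([el_mul], [el_mul_low]). Moreover the identity is
    not a product of other elements, and together with the elements [el i j] it generates
    the monoid. The theorem about the maximal subsemigroups follows from these
    facts alone, collected in [layered].

    Let [M] be a proper subsemigroup. If [M] misses the identity it lies in the
    complement of the identity. Otherwise some [el p q] is not in [M]. If [M]
    misses a whole R-class or L-class of rank [n - 2], it lies in the complement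
    of that class. If not, let [C] be the set of [j] with [el p j] in [M], let
    [A] be the set of [i] without neighbour in [C], and [B] the set of [j]
    without neighbour in [A]. Then [A] and [B] form a maximal independent set of
    Delta; and if [el i j] is in [M] and [i] is not in [A], then [i] has a
    neighbour [c] in [C], so that [el p j = el p c * el i j] is in [M] and [j] is
    in [B] ([proper_sub_crit]). Conversely the subsemigroups of the list are
    maximal, as an additional element of rank [n - 2] generates all others
    ([sub_of_maximal]). A maximal independent set amounts to a word in three
    letters (the R-vertex, the L-vertex or neither at each position) that is
    determined by its first letter and the isolated positions of the letter
    neither; the recursion on these words is that of the Fibonacci numbers
    ([card_mis]).

    The facts about diagrams are obtained as follows. A partition is determined
    by the set of two-colourings of the points that are constant on its blocks,
    seen as a relation between colourings of the unprimed and of the primed row,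
    and the product of partitions is the composition of these relations
    ([compat_dmul]); this gives associativity. Elements of the Jones monoid are
    planar matchings, handled as involutions. Multiplying on the left by the
    diagram [hookd i] with blocks {i, i+1} and {i', (i+1)'} reconnects two blocks
    ([hookd_mul]), which preserves planarity ([surg_planar]). Every diagram
    arises from the identity by such multiplications ([Jones_hookd_ind]), so that
    closure under products and the behaviour of the rank need be checked for
    these only. The anti-involution [flip] exchanging the two rows transfers
    results from one side to the other. *)

Set Implicit Arguments.
Unset Strict Implicit.
Unset Printing Implicit Defensive.

(** * Partitions as relations between labelings *)

Section Labelings.
Variable n : nat.
Implicit Types (a b c : dpart n) (x y z : point n) (f g h : 'I_n -> bool).

Lemma cover_blocks a x : x \in cover (blocks a).
Proof. by have /and3P [/eqP -> _ _] := blocksP a; rewrite inE. Qed.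

Lemma trivIset_blocks a : trivIset (blocks a).
Proof. by have /and3P [] := blocksP a. Qed.

Lemma same_blockE a x y :
  same_block a x y = (pblock (blocks a) x == pblock (blocks a) y).
Proof. by rewrite eq_pblock ?trivIset_blocks ?cover_blocks. Qed.

Lemma same_block_refl a x : same_block a x x.
Proof. by rewrite same_blockE. Qed.

Lemma same_block_ext a b : same_block a =2 same_block b -> a = b.
Proof.
move=> ab; apply: val_inj => /=.
rewrite -(equivalence_partition_pblock (blocksP a)).
rewrite -(equivalence_partition_pblock (blocksP b)).
rewrite /equivalence_partition; apply: eq_imset => x.
by apply/setP => y; rewrite !inE; apply: ab.
Qed.

(** The labeling of the points by [f] on the unprimed and [h] on the primed
    ones. *)
Definition label f h x := match x with inl i => f i | inr i => h i end.

(** [compat a] relates [f] and [h] when [label f h] is constant on the blocks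
    of [a]. *)
Definition compat a f h :=
  forall x y, same_block a x y -> label f h x = label f h y.

Lemma compat_ext a b : (forall f h, compat a f h <-> compat b f h) -> a = b.
Proof.
have sub c d : (forall f h, compat c f h -> compat d f h) ->
    forall x y, same_block d x y -> same_block c x y.
  move=> cd x y dxy; pose s i := same_block c x (inl i).
  pose t i := same_block c x (inr i).
  have E z : label s t z = same_block c x z by case: z.
  have /cd/(_ _ _ dxy) : compat c s t.
    by move=> u v; rewrite !E !same_blockE => /eqP ->.
  by rewrite !E same_block_refl => <-.
move=> ab; apply: same_block_ext => x y.
by apply/idP/idP; apply: sub => f h; apply: (iffLR (ab f h)) || apply: (iffRL (ab f h)).
Qed.

Lemma same_block_dmul a b x y :
  same_block (dmul a b) x y = glue_closure a b (inl x) (inl y).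
Proof.
rewrite /same_block /= pblock_equivalence_partition ?inE // => u v w _ _ _.
exact: glue_closure_equiv.
Qed.

(** The product of partitions is the composition of the relations [compat]:
    a labeling that is constant on the blocks of the product extends to the
    middle row. *)
Lemma compat_dmul a b f h :
  compat (dmul a b) f h <-> exists2 g, compat a f g & compat b g h.
Proof.
pose lab g (u : point3 n) :=
  match u with inl (inl i) => f i | inl (inr i) => h i | inr i => g i end.
have labE g x : lab g (inl x) = label f h x by case: x.
have labm g x : lab g (prime_to_middle x) = label f g x by case: x.
have labu g x : lab g (unprimed_to_middle x) = label g h x by case: x.
split=> [ab | [g ag gb] x y].
  have /equivalence_relP [er etr] := glue_closure_equiv a b.
  pose g (i : 'I_n) :=
    if [pick x | glue_closure a b (inr i) (inl x)] is Some x then label f h x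
    else false.
  have gE i x : glue_closure a b (inr i) (inl x) -> g i = label f h x.
    rewrite /g => ix; case: pickP => [y iy | /(_ x)]; last by rewrite ix.
    by apply: ab; rewrite same_block_dmul -(etr _ _ iy).
  have labgl u v : glue_closure a b u v -> lab g u = lab g v.
    have L x v' : glue_closure a b (inl x) v' -> label f h x = lab g v'.
      case: v' => [y|i] uv; first by rewrite labE; apply: ab; rewrite same_block_dmul.
      by rewrite /= (gE i x) // -(etr _ _ uv) er.
    case: u v => [x|i] [y|j] uv; rewrite ?labE.
    - by rewrite (L _ _ uv) labE.
    - exact: L uv.
    - by rewrite (L y (inr i)) // -(etr _ _ uv) er.
    rewrite /= /g; congr (if _ is Some x then label f h x else false).
    by apply: eq_pick => x; rewrite (etr _ _ uv).
  exists g => x y xy; rewrite -?labm -?labu; apply/labgl/connect1/orP.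
    by left; apply/existsP; exists x; apply/existsP; exists y; rewrite !eqxx.
  by right; apply/existsP; exists x; apply/existsP; exists y; rewrite !eqxx.
rewrite same_block_dmul => xy; rewrite -!(labE g); apply/eqP.
apply: (@glue_closure_min n a b (fun u v => lab g u == lab g v) _ _ _ _ xy).
  by move=> u v w; split=> // /eqP ->.
move=> u v /orP [] /existsP [s /existsP [t /and3P [/eqP -> /eqP -> st]]].
  by rewrite !labm (ag _ _ st).
by rewrite !labu (gb _ _ st).
Qed.

Lemma dmulA a b c : dmul a (dmul b c) = dmul (dmul a b) c.
Proof.
apply: compat_ext => f h; split.
  case/compat_dmul => g ag /compat_dmul [k gk kh].
  by apply/compat_dmul; exists k => //; apply/compat_dmul; exists g.
case/compat_dmul => k /compat_dmul [g fg gk] kh.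
by apply/compat_dmul; exists g => //; apply/compat_dmul; exists k.
Qed.

End Labelings.

(** * Planar matchings *)

Section Matchings.
Variable n : nat.
Implicit Types (x y z p q : point n) (mu : point n -> point n).

(** The exchange of the two rows. *)
Definition swap x : point n := match x with inl i => inr i | inr i => inl i end.

Lemma swapK : involutive swap. Proof. by case. Qed.

Lemma pos_inj : injective (@pos n).
Proof.
case=> [[i hi]|[i hi]] [[j hj]|[j hj]] /= E; try by lia.
  by congr inl; apply: val_inj => /=; lia.
by congr inr; apply: val_inj => /=; lia.
Qed.

Lemma pos_swap x : pos (swap x) = 2 * n - 1 - pos x.
Proof. by case: x => -[i hi] /=; lia. Qed.

Lemma pos_lt x : pos x < 2 * n.
Proof. by case: x => -[i hi] /=; lia. Qed.

Lemma pos_flip x y : x != y -> (pos y < pos x) = ~~ (pos x < pos y).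
Proof.
move=> xy; have : pos x != pos y by rewrite (inj_eq pos_inj).
by case: ltngtP.
Qed.

(** The point [a] lies strictly between [p] and [q] (for [a] distinct from
    both). *)
Definition sep p q (a : point n) : bool := (pos p < pos a) (+) (pos q < pos a).

Lemma sep_sym p q a : sep p q a = sep q p a. Proof. exact: addbC. Qed.

Lemma sep_exchange x x' a a' :
  a != x -> a != x' -> a' != x -> a' != x' ->
  sep x x' a = sep x x' a' -> sep a a' x = sep a a' x'.
Proof.
rewrite /sep => h1 h2 h3 h4; rewrite !(@pos_flip a) // !(@pos_flip a') //.
by do 4!case: (_ < _).
Qed.

(** A planar matching, as the involution exchanging the two points of each
    block; non-crossing is expressed by [sep]. *)
Definition planar_matching (mu : point n -> point n) : Prop :=
  [/\ involutive mu, forall x, mu x != x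
    & forall x a, a != x -> a != mu x -> sep x (mu x) a = sep x (mu x) (mu a)].

(** The partition with blocks the pairs [{x, mu x}]. *)
Definition of_matching (mu : point n -> point n) : dpart n :=
  DPart (preim_partitionP (fun x => [set x; mu x]) [set: point n]).

Lemma same_block_of mu x y : involutive mu ->
  same_block (of_matching mu) x y = (y == x) || (y == mu x).
Proof.
move=> muK; rewrite /same_block /= pblock_equivalence_partition ?inE //; last first.
  by move=> u v w _ _ _; split=> // /eqP ->.
apply/eqP/orP => [E | [] /eqP -> //]; last by rewrite muK setUC.
by have: y \in [set x; mu x] by [rewrite E !inE eqxx]; rewrite !inE => /orP.
Qed.

(** The other point of the block of [x], for partitions with blocks of size
    2. *)
Definition mate (a : dpart n) x : point n :=
  odflt x [pick y | (y != x) && same_block a x y].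

Lemma mate_of mu : involutive mu -> (forall x, mu x != x) -> mate (of_matching mu) =1 mu.
Proof.
move=> muK mux x; rewrite /mate; case: pickP => [y|/(_ (mu x))] /=.
  by rewrite same_block_of // => /andP [/negbTE ->] /= /eqP.
by rewrite same_block_of // mux eqxx orbT.
Qed.

Lemma Jones_same_block a x y : a \in Jones n ->
  same_block a x y = (y == x) || (y == mate a x).
Proof.
rewrite inE => /andP [_ /forall_inP a2].
have /a2/cards2P [u [v [uv E]]] : pblock (blocks a) x \in blocks a.
  by rewrite pblock_mem ?cover_blocks.
have : same_block a x x := same_block_refl a x.
rewrite /mate /same_block E => xuv; case: pickP => [z|].
  by move: xuv; rewrite !inE => /orP [] /eqP -> /andP [/negbTE ->] /=;
    rewrite ?orbF => /eqP -> //=; rewrite orbC.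
move: xuv; rewrite !inE => /orP [] /eqP -> /=.
  by move/(_ v); rewrite !inE eqxx orbT eq_sym uv.
by move/(_ u); rewrite !inE eqxx uv.
Qed.

Lemma mateK a : a \in Jones n -> involutive (mate a).
Proof.
move=> aJ x; have: same_block a (mate a x) x.
  by rewrite same_block_sym Jones_same_block // eqxx orbT.
rewrite Jones_same_block // => /orP [] /eqP // E; by rewrite -E.
Qed.

Lemma mate_neq a x : a \in Jones n -> mate a x != x.
Proof.
move=> aJ; have := aJ; rewrite inE => /andP [_ /forall_inP a2].
have /a2/eqP : pblock (blocks a) x \in blocks a.
  by rewrite pblock_mem ?cover_blocks.
have -> : pblock (blocks a) x = [set x; mate a x].
  by apply/setP => y; rewrite !inE -Jones_same_block.
by rewrite cards2 eq_sym; case: eqP.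
Qed.

Lemma Jones_pblock a x : a \in Jones n ->
  pblock (blocks a) x = [set x; mate a x].
Proof. by move=> aJ; apply/setP => y; rewrite !inE -Jones_same_block. Qed.

Lemma Jones_blocks a x y : a \in Jones n -> x != y ->
  ([set x; y] \in blocks a) = (mate a x == y).
Proof.
move=> aJ xy; apply/idP/eqP => [xyB | <-].
  have : same_block a x y.
    by rewrite /same_block (def_pblock (trivIset_blocks a) xyB) !inE eqxx ?orbT.
  by rewrite Jones_same_block // eq_sym (negbTE xy) => /eqP.
by rewrite -Jones_pblock // pblock_mem ?cover_blocks.
Qed.

Lemma Jones_ext a b : a \in Jones n -> b \in Jones n -> mate a =1 mate b -> a = b.
Proof.
move=> aJ bJ ab; apply: same_block_ext => x y.
by rewrite !Jones_same_block // ab.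
Qed.

Lemma Jones_matching a : a \in Jones n -> planar_matching (mate a).
Proof.
move=> aJ; have mK := mateK aJ; have mn x := mate_neq x aJ.
split=> // x y yx ymx.
have myx : mate a y != x by apply: contra ymx => /eqP <-; rewrite mK.
have mymx : mate a y != mate a x by rewrite (inj_eq (can_inj mK)).
have := aJ; rewrite inE => /andP [/negP pl _].
have cross u v : v != u -> v != mate a u ->
    pos u < pos v -> pos v < pos (mate a u) -> pos (mate a u) < pos (mate a v) -> False.
  move=> vu vmu h1 h2 h3; apply: pl.
  apply/exists_inP; exists (pblock (blocks a) u); first by rewrite pblock_mem ?cover_blocks.
  apply/exists_inP; exists (pblock (blocks a) v); first by rewrite pblock_mem ?cover_blocks.
  apply/andP; split.
    by rewrite -same_blockE Jones_same_block // negb_or vu.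
  rewrite !Jones_pblock //.
  apply/exists_inP; exists u; first by rewrite !inE eqxx.
  apply/exists_inP; exists (mate a u); first by rewrite !inE eqxx orbT.
  apply/exists_inP; exists v; first by rewrite !inE eqxx.
  apply/exists_inP; exists (mate a v); first by rewrite !inE eqxx orbT.
  by rewrite h1 h2 h3.
have S u v : [|| v == u | v == mate a u] = false ->
   ~ (pos u < pos v < pos (mate a u) /\ pos (mate a u) < pos (mate a v)).
  by move/negbT; rewrite negb_or => /andP [h1 h2] [/andP [h3 h4] h5]; apply: (cross u v).
(* A crossing contradicts [pl] whichever of the four points comes first. *)
have := S x y; have := S (mate a x) y; have := S x (mate a y).
have := S (mate a x) (mate a y); have := S y x; have := S (mate a y) x.
have := S y (mate a x); have := S (mate a y) (mate a x).
rewrite !mK !(eq_sym x) !(eq_sym (mate a x)) (negbTE yx) (negbTE ymx)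
  (negbTE myx) (negbTE mymx) /=.
move=> /(_ erefl) s1 /(_ erefl) s2 /(_ erefl) s3 /(_ erefl) s4.
move=> /(_ erefl) s5 /(_ erefl) s6 /(_ erefl) s7 /(_ erefl) s8.
rewrite -!(inj_eq pos_inj) in yx ymx myx mymx.
have := mn x; have := mn y; rewrite -!(inj_eq pos_inj) => n1 n2.
rewrite /sep; clear -s1 s2 s3 s4 s5 s6 s7 s8 yx ymx myx mymx n1 n2.
case: (ltnP (pos x) (pos y)) => h1; case: (ltnP (pos (mate a x)) (pos y)) => h2;
case: (ltnP (pos x) (pos (mate a y))) => h3;
case: (ltnP (pos (mate a x)) (pos (mate a y))) => h4 //=; exfalso; lia.
Qed.

Lemma of_matching_Jones mu : planar_matching mu -> of_matching mu \in Jones n.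
Proof.
case=> muK mun mup; have sb := same_block_of _ _ muK.
have blk A z : A \in blocks (of_matching mu) -> z \in A -> A = [set z; mu z].
  move=> AB zA; rewrite -(def_pblock (trivIset_blocks _) AB zA).
  by apply/setP => y; rewrite !inE -sb.
rewrite inE; apply/andP; split; last first.
  apply/forall_inP => A AB; have /set0Pn [z zA] : A != set0.
    by have /and3P [_ _ n0] := blocksP (of_matching mu); apply: contraNneq n0 => <-.
  by rewrite (blk _ _ AB zA) cards2 (eq_sym z) mun.
apply/negP => /exists_inP [A AB /exists_inP [X XB /andP [AX]]].
case/exists_inP => a aA /exists_inP [b bA /exists_inP [x xX /exists_inP [y yX]]].
case/and3P => h1 h2 h3.
have EA := blk _ _ AB aA; have EX := blk _ _ XB xX.
have eb : b = mu a by move: bA; rewrite EA !inE => /orP [] /eqP // E; move: h1 h2; rewrite E; lia.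
have ey : y = mu x by move: yX; rewrite EX !inE => /orP [] /eqP // E; move: h3 h2; rewrite E; lia.
have xa : x != a by apply: contra_neq AX => E; rewrite EA EX E.
have xma : x != mu a by apply: contra_neq AX => E; rewrite EA EX E muK setUC.
have := mup a x xa xma; rewrite -eb -ey /sep h1 h3; lia.
Qed.

(** * Reconnecting two blocks *)

(** The points [p] and [q] become mates, and so do their former mates. *)
Definition surg (mu : point n -> point n) p q : point n -> point n :=
  fun z => if z == p then q else if z == q then p
           else if z == mu p then mu q else if z == mu q then mu p else mu z.

Lemma surg_sym mu p q : surg mu p q =1 surg mu q p.
Proof.
move=> z; rewrite /surg; have [->|zp] := eqVneq z p.
  by have [->|] := eqVneq.
have [//|zq] := eqVneq z q; have [->|] := eqVneq z (mu p) => //.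
by have [->|] := eqVneq.
Qed.

Section Surgery.
Variables (mu : point n -> point n) (muP : planar_matching mu) (p q : point n).
Hypothesis pq : p != q.

Let muK : involutive mu. Proof. by case: muP. Qed.
Let mun x : mu x != x. Proof. by case: muP. Qed.
Let mu_eq x y : (mu x == y) = (x == mu y).
Proof. by rewrite -(inj_eq (can_inj muK)) muK. Qed.

Lemma surg_id : mu p = q -> surg mu p q =1 mu.
Proof.
move=> E z; rewrite /surg; have Eq : mu q = p by rewrite -E muK.
by have [->//|] := eqVneq z p; have [->//|] := eqVneq z q; rewrite Eq E => /negbTE -> /negbTE ->.
Qed.

Lemma surgL : surg mu p q p = q. Proof. by rewrite /surg eqxx. Qed.

Lemma surgR : surg mu p q q = p.
Proof. by rewrite /surg eqxx eq_sym (negbTE pq). Qed.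

Lemma surg_mateL : mu p != q -> surg mu p q (mu p) = mu q.
Proof. by move=> h; rewrite /surg (negbTE (mun p)) (negbTE h) eqxx. Qed.

Lemma surg_mateR : mu p != q -> surg mu p q (mu q) = mu p.
Proof.
move=> h; rewrite /surg mu_eq eq_sym (negbTE h) (negbTE (mun q)).
by rewrite (inj_eq (can_inj muK)) eq_sym (negbTE pq) eqxx.
Qed.

Lemma surgN z : z != p -> z != q -> z != mu p -> z != mu q -> surg mu p q z = mu z.
Proof. by rewrite /surg => /negbTE -> /negbTE -> /negbTE -> /negbTE ->. Qed.

(** Surgery keeps a matching planar when neither another block nor the second
    new pair crosses the pair of [p] and [q]. *)
Lemma surg_planar :
  (forall a, a != p -> a != q -> a != mu p -> a != mu q ->
     sep p q a = sep p q (mu a)) ->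
  (mu p != q -> sep p q (mu p) = sep p q (mu q)) ->
  planar_matching (surg mu p q).
Proof.
move=> H1 H2; have [E|npq] := eqVneq (mu p) q.
  case: muP => _ _ mup; split=> [x | x | x a]; rewrite !(surg_id E) //; exact: mup.
have {}H2 := H2 npq.
have cs z : [\/ z = p, z = q, z = mu p | z = mu q \/
   [/\ z != p, z != q, z != mu p & z != mu q]].
  have [->|h1] := eqVneq z p; first by constructor 1.
  have [->|h2] := eqVneq z q; first by constructor 2.
  have [->|h3] := eqVneq z (mu p); first by constructor 3.
  have [->|h4] := eqVneq z (mu q); first by constructor 4; left.
  by constructor 4; right.
have mqp : mu q != p by rewrite mu_eq eq_sym.
have mpq : mu p != mu q by rewrite (inj_eq (can_inj muK)).
have nmu z : [/\ z != p, z != q, z != mu p & z != mu q] ->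
    [/\ mu z != p, mu z != q, mu z != mu p & mu z != mu q].
  by case=> *; split; rewrite ?(inj_eq (can_inj muK)) // mu_eq.
have sK : involutive (surg mu p q).
  move=> z; case: (cs z) => [->|->|->|[->|[h1 h2 h3 h4]]].
  + by rewrite surgL surgR.
  + by rewrite surgR surgL.
  + by rewrite surg_mateL // surg_mateR.
  + by rewrite surg_mateR // surg_mateL.
  case: (nmu z) => // *; by rewrite (surgN (z := z)) // surgN // muK.
split=> //.
  move=> z; case: (cs z) => [->|->|->|[->|[h1 h2 h3 h4]]].
  + by rewrite surgL eq_sym.
  + by rewrite surgR.
  + by rewrite surg_mateL // eq_sym.
  + by rewrite surg_mateR.
  by rewrite surgN.
have mup x a : a != x -> a != mu x -> sep x (mu x) a = sep x (mu x) (mu a).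
  by case: muP => _ _; apply.
(* Modulo 2, the pair {a, mu a} crosses {mu p, mu q} as often as it crosses the
   pairs {p, mu p}, {q, mu q} and {p, q} together. *)
have K1 a : [/\ a != p, a != q, a != mu p & a != mu q] ->
    sep (mu p) (mu q) a = sep (mu p) (mu q) (mu a).
  case=> h1 h2 h3 h4; have := H1 a h1 h2 h3 h4.
  have := mup p a h1 h3; have := mup q a h2 h4; rewrite /sep.
  by do 8!case: (_ < _).
have K2 : sep (mu p) (mu q) p = sep (mu p) (mu q) q.
  by apply: sep_exchange => //; rewrite ?mun // eq_sym.
have main x a : a != x -> a != surg mu p q x ->
    [\/ x = p, x = mu p | [/\ x != p, x != q, x != mu p & x != mu q]] ->
    [\/ a = p, a = mu p | [/\ a != p, a != q, a != mu p & a != mu q]] ->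
  sep x (surg mu p q x) a = sep x (surg mu p q x) (surg mu p q a).
  move=> ax asx [Ex|Ex|Nx] [Ea|Ea|Na]; move: ax asx; rewrite ?Ex ?Ea ?eqxx //.
  - by rewrite surgL surg_mateL.
  - case: Na => h1 h2 h3 h4 _ _; rewrite surgL surgN //; exact: H1.
  - by rewrite surgL surg_mateL.
  - by rewrite surg_mateL // surgN //; case: Na => // *; apply: K1.
  - case: (Nx) => h1 h2 h3 h4; rewrite surgL (surgN (z := x)) // => _ _.
    case: (nmu x) => // m1 m2 m3 m4; apply: sep_exchange => //; exact: H1.
  - case: (Nx) => h1 h2 h3 h4; rewrite surg_mateL // (surgN (z := x)) // => _ _.
    case: (nmu x) => // m1 m2 m3 m4; apply: sep_exchange => //; exact: K1.
  case: (Nx) (Na) => h1 h2 h3 h4 [k1 k2 k3 k4].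
  by rewrite !surgN //; apply: mup.
(* As [sep] is symmetric, one point of each new pair is enough. *)
have red x : exists2 x', [\/ x' = p, x' = mu p |
    [/\ x' != p, x' != q, x' != mu p & x' != mu q]] & x = x' \/ x = surg mu p q x'.
  case: (cs x) => [E|E|E|[E|N]].
  - by exists p; [constructor 1 | left].
  - by exists p; [constructor 1 | right; rewrite surgL].
  - by exists (mu p); [constructor 2 | left].
  - by exists (mu p); [constructor 2 | right; rewrite surg_mateL].
  - by exists x; [constructor 3 | left].
move=> x a; have [x' Px hx] := red x; have [a' Pa ha] := red a.
have M := main _ _ _ _ Px Pa; have sI := inj_eq (can_inj sK).
have sE u v : (surg mu p q u == v) = (u == surg mu p q v) by rewrite -sI sK.
by case: hx ha => -> [] ->; rewrite ?sK ?sI ?sE => h1 h2;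
  rewrite ?(sep_sym (surg _ _ _ _) x') M.
Qed.

(** Undoing a surgery: if [p] and [q] are mates and [q] is reconnected to a
    third point [s], then reconnecting [p] and [q] gives back [mu]. *)
Lemma surgK s : mu p = q -> s != p -> s != q ->
  surg (surg mu q s) p q =1 mu.
Proof.
move=> mpq sp sq z; have mqp : mu q = p by rewrite -mpq muK.
have msp : mu s != p by rewrite mu_eq mpq.
have msq : mu s != q by rewrite mu_eq mqp.
have Ep : surg mu q s p = mu s.
  by rewrite /surg mqp eqxx (negbTE pq) eq_sym (negbTE sp).
have Eq : surg mu q s q = s by rewrite /surg eqxx.
set nu := surg mu q s in Ep Eq *; rewrite /surg Ep Eq.
have [->//|zp] := eqVneq z p; have [->//|zq] := eqVneq z q.
have [->|zms] := eqVneq z (mu s); first by rewrite muK.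
have [->//|zs] := eqVneq z s.
by rewrite /nu /surg mqp (negbTE zp) (negbTE zq) (negbTE zs) (negbTE zms).
Qed.

End Surgery.

End Matchings.

(** * Products with the hook diagrams *)

Section Diagrams.
Variable n : nat.
Implicit Types (x y z : point n) (a b c : dpart n) (mu : point n -> point n).
Implicit Types (f g h : 'I_n -> bool).

Lemma swap_planar : planar_matching (@swap n).
Proof.
split=> [|x|x u]; [exact: swapK | by case: x | ].
by rewrite -!(inj_eq (@pos_inj n)) /sep !pos_swap; have := pos_lt x; have := pos_lt u; lia.
Qed.

Lemma compat_of mu f h : involutive mu ->
  compat (of_matching mu) f h <-> forall x, label f h (mu x) = label f h x.
Proof.
move=> muK; split=> [cm x | E x y]; first by symmetry; apply: cm; rewrite same_block_of // eqxx orbT.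
by rewrite same_block_of // => /orP [] /eqP ->.
Qed.

Lemma compat_mate a f h : a \in Jones n ->
  compat a f h <-> forall x, label f h (mate a x) = label f h x.
Proof.
move=> aJ; split=> [cm x | E x y]; first by symmetry; apply: cm; rewrite Jones_same_block // eqxx orbT.
by rewrite Jones_same_block // => /orP [] /eqP ->.
Qed.

Lemma did_of_swap : did n = of_matching (@swap n).
Proof.
apply: same_block_ext => x y; rewrite same_block_of; last exact: swapK.
have B (i : 'I_n) : [set inl i; inr i] \in blocks (did n) by apply/imsetP; exists i.
rewrite /same_block; case: x => i /=;
  rewrite (def_pblock (trivIset_blocks _) (B i)) ?inE ?eqxx ?orbT //.
by rewrite orbC.
Qed.

Lemma did_Jones : did n \in Jones n.
Proof. by rewrite did_of_swap; apply: of_matching_Jones; apply: swap_planar. Qed.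

Lemma mate_did : mate (did n) =1 @swap n.
Proof. by rewrite did_of_swap; apply: mate_of; [exact: swapK | case]. Qed.

Lemma compat_did f h : compat (did n) f h <-> f =1 h.
Proof.
rewrite did_of_swap compat_of; last exact: swapK.
by split=> [E i | E [] i /=]; [exact: (E (inr i)) | rewrite E | rewrite E].
Qed.

Lemma compat_eq1 a f f' h h' : f =1 f' -> h =1 h' -> compat a f h -> compat a f' h'.
Proof.
move=> ff hh cm x y /cm; have E z : label f h z = label f' h' z by case: z => i /=.
by rewrite !E.
Qed.

Lemma dmul1 a : dmul (did n) a = a.
Proof.
apply: compat_ext => f h; rewrite compat_dmul; split=> [[g /compat_did fg]|ah].
  by apply: compat_eq1 => // i; rewrite fg.
by exists f => //; apply/compat_did.
Qed.

Lemma dmul_1 a : dmul a (did n) = a.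
Proof.
apply: compat_ext => f h; rewrite compat_dmul; split=> [[g ag /compat_did fg]|ah].
  by apply: compat_eq1 ag.
by exists h => //; apply/compat_did.
Qed.

Lemma lo_hi (i : 'I_n.-1) : lo i != hi i.
Proof. by rewrite -(inj_eq val_inj) /=; lia. Qed.

Lemma inl_eq (u v : 'I_n) : (inl u == inl v :> point n) = (u == v). Proof. by []. Qed.
Lemma inr_eq (u v : 'I_n) : (inr u == inr v :> point n) = (u == v). Proof. by []. Qed.

Lemma lo_hi_inl (i : 'I_n.-1) : inl (lo i) != inl (hi i) :> point n.
Proof. by rewrite inl_eq lo_hi. Qed.

Lemma sep_hook (i : 'I_n.-1) z : z != inl (lo i) -> z != inl (hi i) ->
  sep (inl (lo i)) (inl (hi i)) z = false.
Proof. by rewrite -!(inj_eq (@pos_inj n)) /sep /= => h1 h2; lia. Qed.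

Lemma surg_hook_planar mu (i : 'I_n.-1) : planar_matching mu ->
  planar_matching (surg mu (inl (lo i)) (inl (hi i))).
Proof.
move=> muP; have [muK mun _] := muP.
have mE u v : (mu u == v) = (u == mu v) by rewrite -(inj_eq (can_inj muK)) muK.
apply: surg_planar => // [|z z1 z2 z3 z4 | npq]; first exact: lo_hi_inl.
  by rewrite !sep_hook ?mE.
by rewrite !sep_hook // mE eq_sym.
Qed.

(** The diagram of rank [n - 2] with the two blocks [{lo i, hi i}] and
    [{(lo i)', (hi i)'}], all others vertical. *)
Definition hookd (i : 'I_n.-1) : dpart n :=
  of_matching (surg (@swap n) (inl (lo i)) (inl (hi i))).

Lemma hookd_Jones (i : 'I_n.-1) : hookd i \in Jones n.
Proof. by apply/of_matching_Jones/surg_hook_planar/swap_planar. Qed.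

Lemma mate_hookd (i : 'I_n.-1) : mate (hookd i) =1 surg (@swap n) (inl (lo i)) (inl (hi i)).
Proof. by have [] := surg_hook_planar i swap_planar => *; apply: mate_of. Qed.

Lemma compat_hookd (i : 'I_n.-1) f g : compat (hookd i) f g <->
  [/\ f (lo i) = f (hi i), g (lo i) = g (hi i)
    & forall j, j != lo i -> j != hi i -> f j = g j].
Proof.
have pq := lo_hi i; have swp := swap_planar.
rewrite compat_mate ?hookd_Jones //; split=> [E | [E1 E2 E3] x].
  split.
  - by have := E (inl (lo i)); rewrite mate_hookd surgL.
  - have := E (inr (lo i)); rewrite mate_hookd -[inr _]/(swap (inl (lo i))).
    by rewrite surg_mateL.
  - move=> j j1 j2; have := E (inl j); rewrite mate_hookd surgN //.
rewrite mate_hookd /surg.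
have [->/=|x1] := eqVneq x (inl (lo i)); first by rewrite E1.
have [->/=|x2] := eqVneq x (inl (hi i)); first by rewrite E1.
have [->/=|x3] := eqVneq x; first by rewrite E2.
have [->/=|x4] := eqVneq x; first by rewrite E2.
by case: x x1 x2 x3 x4 => j /= *; rewrite E3.
Qed.

(** Multiplying by [hookd i] on the left connects the [i]-th and the next
    unprimed points, and their former mates. *)
Lemma hookd_mul (i : 'I_n.-1) b : b \in Jones n ->
  dmul (hookd i) b = of_matching (surg (mate b) (inl (lo i)) (inl (hi i))).
Proof.
move=> bJ; have muP := Jones_matching bJ; have [muK mun _] := muP.
have [sK _ _] := surg_hook_planar i muP.
have pq := lo_hi_inl i.
set mu := mate b in muP muK mun sK *; set p := inl (lo i) in pq sK *.
set q := inl (hi i) in pq sK *.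
have mE u v : (mu u == v) = (u == mu v) by rewrite -(inj_eq (can_inj muK)) muK.
have L f g h : (forall j, j != lo i -> j != hi i -> f j = g j) ->
    forall z, z != p -> z != q -> label f h z = label g h z.
  by move=> E [] j //= j1 j2; rewrite E.
apply: compat_ext => f h; rewrite compat_dmul compat_of //; split.
  case=> g /compat_hookd [E1 E2 E3] /(compat_mate _ _ bJ) E x.
  rewrite -/mu in E; have {}L := L _ _ h E3.
  have [mpq|npq] := eqVneq (mu p) q.
    have mqp : mu q = p by rewrite -mpq muK.
    rewrite surg_id //; have [->|x1] := eqVneq x p; first by rewrite mpq.
    have [->|x2] := eqVneq x q; first by rewrite mqp.
    by rewrite !L ?E // mE ?mpq ?mqp.
  have mqp : mu q != p by rewrite mE eq_sym.
  have [->|x1] := eqVneq x p; first by rewrite surgL.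
  have [->|x2] := eqVneq x q; first by rewrite surgR.
  have [->|x3] := eqVneq x (mu p); first by rewrite surg_mateL // !L ?E.
  have [->|x4] := eqVneq x (mu q); first by rewrite surg_mateR // !L ?E.
  by rewrite surgN // !L ?E // mE.
move=> E; have Epq : f (lo i) = f (hi i) by have := E q; rewrite surgR.
have [mpq|npq] := eqVneq (mu p) q.
  exists f; first by apply/compat_hookd.
  by apply/compat_mate => // x; rewrite -[mate b x](surg_id muP mpq).
pose v := label f h (mu p).
pose g j := if (j == lo i) || (j == hi i) then v else f j.
have gE j : j != lo i -> j != hi i -> f j = g j.
  by rewrite /g => /negbTE -> /negbTE ->.
have gp : label g h p = v by rewrite /= /g eqxx.
have gq : label g h q = v by rewrite /= /g eqxx orbT.
have mqp : mu q != p by rewrite mE eq_sym.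
exists g; first by apply/compat_hookd; split=> //; rewrite /g !eqxx orbT.
apply/compat_mate => // x; rewrite -/mu.
have {}L := L _ _ h gE.
have Ep : label g h (mu p) = v by rewrite -L.
have Eq : label g h (mu q) = v by rewrite -L // -(surg_mateL muP npq) E.
have [->|x1] := eqVneq x p; first by rewrite Ep gp.
have [->|x2] := eqVneq x q; first by rewrite Eq gq.
have [->|x3] := eqVneq x (mu p); first by rewrite muK Ep gp.
have [->|x4] := eqVneq x (mu q); first by rewrite muK Eq gq.
by have := E x; rewrite surgN // !L // mE.
Qed.

Lemma hookd_mul_Jones (i : 'I_n.-1) b : b \in Jones n -> dmul (hookd i) b \in Jones n.
Proof.
by move=> bJ; rewrite hookd_mul //; apply/of_matching_Jones/surg_hook_planar/Jones_matching.
Qed.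

Lemma mate_hookd_mul (i : 'I_n.-1) b : b \in Jones n ->
  mate (dmul (hookd i) b) =1 surg (mate b) (inl (lo i)) (inl (hi i)).
Proof.
move=> bJ; rewrite hookd_mul //.
by have [] := surg_hook_planar i (Jones_matching bJ) => *; apply: mate_of.
Qed.

(** [a] has the block [{lo i, hi i}]. *)
Definition uhook a (i : 'I_n.-1) : bool := mate a (inl (lo i)) == inl (hi i).

Lemma uhook_hookd_mul (i : 'I_n.-1) b : b \in Jones n -> uhook (dmul (hookd i) b) i.
Proof. by move=> bJ; rewrite /uhook mate_hookd_mul // surgL. Qed.

Lemma uhook_hookd (i : 'I_n.-1) : uhook (hookd i) i.
Proof. by rewrite -(dmul_1 (hookd i)) uhook_hookd_mul // did_Jones. Qed.

Lemma uhook_absorb (i : 'I_n.-1) b : b \in Jones n -> uhook b i -> dmul (hookd i) b = b.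
Proof.
move=> bJ /eqP bi; apply: Jones_ext => //; first exact: hookd_mul_Jones.
by move=> z; rewrite mate_hookd_mul // surg_id //; apply: Jones_matching.
Qed.

(** For neighbouring [i] and [j], a hook at [i] is moved to [j] by [hookd j] and
    back by [hookd i]. *)
Lemma uhook_slide (i j : 'I_n.-1) a : a \in Jones n -> uhook a i ->
  (j == i.+1 :> nat) || (i == j.+1 :> nat) ->
  dmul (hookd i) (dmul (hookd j) a) = a.
Proof.
move=> aJ /eqP ai /orP ij; have muP := Jones_matching aJ; have [muK _ _] := muP.
apply: Jones_ext => //; first by do 2!apply: hookd_mul_Jones.
have ai' : mate a (inl (hi i)) = inl (lo i) by rewrite -ai muK.
have surg_eq mu mu' p q : mu =1 mu' -> surg mu p q =1 surg mu' p q.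
  by move=> E u; rewrite /surg !E.
move=> z; rewrite mate_hookd_mul; last exact: hookd_mul_Jones.
rewrite (surg_eq _ _ _ _ (mate_hookd_mul j aJ)).
case: ij => /eqP ij.
  have -> : lo j = hi i by apply: val_inj; rewrite /= ij.
  by apply: surgK => //; rewrite -(inj_eq (@pos_inj n)) /=; lia.
have -> : hi j = lo i by apply: val_inj; rewrite /= ij.
rewrite (surg_eq _ _ _ _ (surg_sym _ _ _)) surg_sym.
by apply: surgK => //; rewrite -(inj_eq (@pos_inj n)) /=; lia.
Qed.

(** * Transverse blocks and hooks *)

Definition primed x := if x is inr _ then true else false.

(** The unprimed, resp. primed, points that lie in transverse blocks. *)
Definition transv a : {set 'I_n} := [set i | primed (mate a (inl i))].
Definition transv' a : {set 'I_n} := [set i | ~~ primed (mate a (inr i))].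

Definition index_of x : 'I_n := match x with inl i => i | inr i => i end.

Lemma index_swap x : index_of (swap x) = index_of x. Proof. by case: x. Qed.

Lemma card_transv' a : a \in Jones n -> #|transv' a| = #|transv a|.
Proof.
move=> aJ; have muK := mateK aJ.
have -> : transv' a = [set index_of (mate a (inl i)) | i in transv a].
  apply/setP => i; rewrite !inE; apply/idP/imsetP.
    case E: (mate a (inr i)) => [j|//] _; exists j; first by rewrite inE -E muK.
    by rewrite -E muK.
  by case=> j; rewrite inE; case E: (mate a (inl j)) => [//|k] _ -> /=; rewrite -E muK.
apply: card_in_imset => i j; rewrite !inE.
case Ei: (mate a (inl i)) => [//|u] _; case Ej: (mate a (inl j)) => [//|v] _ /= uv.
have: mate a (inl i) = mate a (inl j) by rewrite Ei Ej uv.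
by move/(can_inj muK) => [].
Qed.

Lemma rank_transv a : a \in Jones n -> rank a = #|transv a|.
Proof.
move=> aJ; rewrite /rank.
have -> : [set A in blocks a | transverse A] =
    [set pblock (blocks a) (inl i) | i in transv a].
  apply/setP => A; rewrite !inE; apply/andP/imsetP.
    case=> AB /andP [/existsP [i iA] /existsP [j jA]].
    exists i; last by rewrite (def_pblock (trivIset_blocks a) AB iA).
    move: jA; rewrite -(def_pblock (trivIset_blocks a) AB iA) Jones_pblock // !inE /=.
    by move/eqP <-.
  case=> i; rewrite inE => it ->; split; first by rewrite pblock_mem ?cover_blocks.
  rewrite Jones_pblock //; apply/andP; split; apply/existsP.
    by exists i; rewrite !inE eqxx.
  by move: it; case: (mate a (inl i)) => [//|j] _; exists j; rewrite !inE eqxx orbT.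
apply: card_in_imset => i j; rewrite !inE => it jt /eqP.
rewrite -same_blockE Jones_same_block // => /orP [/eqP [] // | /eqP E].
by move: it; rewrite -E.
Qed.

(** In a diagram whose transverse points are the same in both rows, the
    transverse blocks are vertical: planarity makes them increasing. *)
Lemma aligned_vertical a : a \in Jones n -> transv' a = transv a ->
  forall i, i \in transv a -> mate a (inl i) = inr i.
Proof.
move=> aJ tt i; have [muK mun pl] := Jones_matching aJ.
have tE u : primed (mate a (inl u)) = ~~ primed (mate a (inr u)).
  by move/setP/(_ u): tt; rewrite !inE => ->.
have [N] := ubnP (val i); elim: N i => // N IH i iN.
rewrite inE; case Ei: (mate a (inl i)) => [//|k] _.
case: (ltngtP k i) => [ki | ik | /val_inj -> //].
  have kt : k \in transv a by rewrite inE tE -Ei muK.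
  have := IH k ltac:(simpl in *; lia) kt; rewrite -Ei => /(can_inj muK) [kk].
  by move: ki; rewrite kk ltnn.
have : ~~ primed (mate a (inr i)) by rewrite -tE Ei.
case El: (mate a (inr i)) => [l|//] _.
case: (ltngtP l i) => [li | il | /val_inj li].
- have lt : l \in transv a by rewrite inE -El muK.
  have := IH l ltac:(simpl in *; lia) lt; rewrite -El muK => -[ii].
  by move: li; rewrite ii ltnn.
- have := pl (inl i) (inr i); rewrite Ei El /sep /=.
  have kin : (inr i : point n) != inr k by rewrite -(inj_eq (@pos_inj n)) /=; have := ltn_ord k; simpl in *; lia.
  move/(_ isT kin) => /=; have := ltn_ord k; have := ltn_ord l; have := ltn_ord i.
  simpl in *; lia.
by rewrite -Ei -{1}li -El muK.
Qed.

Lemma all_transv_did a : a \in Jones n -> transv a = setT -> a = did n.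
Proof.
move=> aJ tT; have tT' : transv' a = setT.
  by apply/eqP; rewrite eqEcard subsetT /= card_transv' // tT.
have E i : mate a (inl i) = inr i.
  by apply: (aligned_vertical aJ); rewrite tT // tT'.
apply: Jones_ext => //; first exact: did_Jones.
by case=> i; rewrite mate_did ?E //= -E mateK.
Qed.

(** An innermost block among those nested in an unprimed one is a hook. *)
Lemma nested_uhook a (i j : 'I_n) : a \in Jones n -> i < j ->
  mate a (inl i) = inl j -> exists k, uhook a k.
Proof.
move=> aJ; have [muK mun pl] := Jones_matching aJ.
have [N] := ubnP (j - i); elim: N i j => // N IH i j ijN ij E.
have i1n : i < n.-1 by have := ltn_ord j; lia.
pose k := Ordinal i1n.
have loE : lo k = i by apply: val_inj.
have [jE|jE] := eqVneq (val j) i.+1.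
  by exists k; rewrite /uhook loE E inl_eq; apply/eqP/val_inj.
have := pl (inl i) (inl (hi k)); rewrite E -!(inj_eq (@pos_inj n)) /sep /=.
move=> /(_ ltac:(simpl in *; lia) ltac:(simpl in *; lia)).
have := mun (inl (hi k)); case El: (mate a (inl (hi k))) => [l|l];
  rewrite -!(inj_eq (@pos_inj n)) /=; last by simpl in *; lia.
move=> ln S; apply: (IH (hi k) l) => //=; simpl in *; lia.
Qed.

Lemma exists_uhook a : a \in Jones n -> a != did n -> exists k, uhook a k.
Proof.
move=> aJ; have [muK mun pl] := Jones_matching aJ.
have [aT|] := eqVneq (transv a) setT; first by rewrite (all_transv_did aJ aT) eqxx.
rewrite -subTset => /subsetPn [i _]; rewrite inE => it _.
move: it (mun (inl i)); case E: (mate a (inl i)) => [j|//] _; rewrite inl_eq => ji.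
case: (ltngtP i j) => [ij|ij|ij]; first exact: nested_uhook E.
  by apply: (nested_uhook aJ ij); rewrite -E muK.
by move: ji; rewrite -(inj_eq val_inj) /= ij eqxx.
Qed.

(** * Generation by the hook diagrams *)

(** Every planar diagram other than the identity arises from one closer to the
    identity by multiplication by some [hookd i]: a hook is slid to the right until it
    meets the vertical blocks on the right, where it is exchanged for one more
    vertical block. *)
Lemma Jones_hookd_ind (P : dpart n -> Prop) :
  P (did n) ->
  (forall i b, b \in Jones n -> P b -> P (dmul (hookd i) b)) ->
  forall a, a \in Jones n -> P a.
Proof.
move=> P1 PE.
(* Induction on a bound [k] for the positions that are not vertical. *)
have main k : k <= n -> forall a, a \in Jones n ->
    (forall i : 'I_n, k <= i -> mate a (inl i) = inr i) -> P a.
  elim: k => [_ a aJ E|k IH kn a aJ E].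
    suff -> : a = did n by [].
    by apply: all_transv_did => //; apply/setP => i; rewrite !inE E.
  pose K := Ordinal kn.
  have [EK|nEK] := eqVneq (mate a (inl K)) (inr K).
    apply: IH => [|//|i]; first exact: ltnW.
    by rewrite leq_eqVlt => /orP [/eqP ki|]; [have <- : K = i by exact: val_inj | exact: E].
  have [i ai] : exists i, uhook a i.
    by apply: exists_uhook => //; apply: contraNneq nEK => ->; rewrite mate_did.
  (* Induction on the distance from the hook to the position [K]. *)
  have {nEK} [d] : {d | d = k - i.+1} by exists (k - i.+1).
  elim: d i a aJ E ai => [|d IHd] i a aJ E ai di;
    have [muK mun pl] := Jones_matching aJ;
    (have ik : i.+1 <= k
       by rewrite leqNgt; apply/negP => ki; have := E (hi i) ki;
          rewrite -(eqP ai) muK);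
    (have far z : k < index_of z -> mate a z = swap z
       by case: z => u /= /E // <-; rewrite muK).
    (* The hook ends at [K]: reconnecting the two points at [K] makes this
       position vertical. *)
  - have hiK : hi i = K by apply: val_inj; rewrite /=; lia.
    have aK : mate a (inl K) = inl (lo i) by rewrite -hiK -(eqP ai) muK.
    pose mu := surg (mate a) (inl K) (inr K).
    have near z : z != inl K -> z != inr K -> (index_of z == k :> nat) = false.
      by move=> z1 z2; apply/eqP => zk; case: z z1 z2 zk => u /= z1 z2 zk;
        [case/eqP: z1 | case/eqP: z2]; congr (_ _); apply: val_inj.
    have sepK z : z != inl K -> z != inr K -> sep (inl K) (inr K) z = (index_of z < k).
      move=> z1 z2; have := near z z1 z2; rewrite /sep.
      by case: z {z1 z2} => u /=; have := ltn_ord u; lia.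
    have mE u v : (mate a u == v) = (u == mate a v).
      by rewrite -(inj_eq (can_inj muK)) muK.
    have muP : planar_matching mu.
      apply: surg_planar => // [z z1 z2 z3 z4|_].
        rewrite !sepK ?mE //; have n1 := near _ z1 z2.
        have n2 : (index_of (mate a z) == k :> nat) = false by apply: near; rewrite mE.
        case: (ltngtP (index_of z) k) => zk; rewrite ?zk ?eqxx in n1 => //.
          case: (ltngtP (index_of (mate a z)) k) n2 => // kz _.
          by have /(congr1 index_of) := far _ kz; rewrite muK index_swap => E1; move: kz; rewrite -E1; lia.
        by rewrite far // index_swap; lia.
      have mr1 : mate a (inr K) != inl K by rewrite mE aK.
      rewrite aK !sepK //; last first.
        by rewrite inl_eq -(inj_eq val_inj) /=; lia.
      rewrite [LHS]/=.
      have n2 : (index_of (mate a (inr K)) == k :> nat) = false by apply: near.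
      have -> : i < k by lia.
      case: (ltngtP (index_of (mate a (inr K))) k) n2 => // kz _.
      by have /(congr1 index_of) := far _ kz; rewrite muK index_swap => E1; move: kz; rewrite -E1 ltnn.
    have [mK mn _] := muP.
    have mb : mate (of_matching mu) =1 mu by apply: mate_of.
    have bJ : of_matching mu \in Jones n by apply: of_matching_Jones.
    have -> : a = dmul (hookd i) (of_matching mu).
      apply: Jones_ext => //; first exact: hookd_mul_Jones.
      move=> z; rewrite mate_hookd_mul //.
      have -> : surg (mate (of_matching mu)) (inl (lo i)) (inl (hi i)) z =
                surg mu (inl (lo i)) (inl (hi i)) z by rewrite /surg !mb.
      rewrite /mu -hiK surgK //; [exact: lo_hi_inl|exact/eqP].
    apply: (PE _ _ bJ); apply: (IH (ltnW kn)) => // u; rewrite mb leq_eqVlt => /orP [/eqP ku|ku].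
      by have <- : K = u by [exact: val_inj]; rewrite /mu surgL.
    have Ku : u != K by rewrite -(inj_eq val_inj) /=; lia.
    have Eu : mate a (inl u) = inr u by apply: E.
    by rewrite /mu surgN // -?mE Eu.
  (* Otherwise the hook is moved one step to the right. *)
  have jn : i.+1 < n.-1 by lia.
  pose j := Ordinal jn.
  have ij : (j == i.+1 :> nat) || (i == j.+1 :> nat) by rewrite eqxx.
  rewrite -(uhook_slide aJ ai ij); have jJ := hookd_mul_Jones j aJ.
  apply: (PE _ _ jJ); apply: (IHd j) => //; last 1 first.
  - by rewrite /=; lia.
  - move=> u ku; have Eu := E u ku.
    have mE z w : (z == mate a w) = (mate a z == w).
      by rewrite -(inj_eq (can_inj muK)) muK.
    rewrite mate_hookd_mul // surgN // ?mE ?Eu // -(inj_eq (@pos_inj n)) /=; lia.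
  exact: uhook_hookd_mul.
by move=> a aJ; apply: (main n) => // i; rewrite leqNgt ltn_ord.
Qed.

End Diagrams.

(** * The elements of rank [n - 2] *)

(** Neighbouring or equal positions. *)
Definition near m (i j : 'I_m) : bool := (i <= j.+1) && (j <= i.+1).

Section RankStructure.
Variable n : nat.
Implicit Types (x y z : point n) (a b c : dpart n).

Lemma dmul_Jones a b : a \in Jones n -> b \in Jones n -> dmul a b \in Jones n.
Proof.
move=> aJ bJ; elim/Jones_hookd_ind: a / aJ => [|i a _ abJ]; first by rewrite dmul1.
by rewrite -dmulA hookd_mul_Jones.
Qed.

(** The anti-involution exchanging the two rows. *)
Definition flip a : dpart n := of_matching (fun x => swap (mate a (swap x))).

Lemma sep_swap (p q u : point n) : u != p -> u != q ->
  sep (swap p) (swap q) (swap u) = sep p q u.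
Proof.
rewrite -!(inj_eq (@pos_inj n)) /sep !pos_swap.
by have := pos_lt p; have := pos_lt q; have := pos_lt u; lia.
Qed.

Lemma flip_planar a : a \in Jones n ->
  planar_matching (fun x => swap (mate a (swap x))).
Proof.
move=> aJ; have [muK mun pl] := Jones_matching aJ.
have sE u v : (swap u == v) = (u == swap v :> point n).
  by rewrite -(inj_eq (can_inj (@swapK n))) swapK.
have mE u v : (mate a u == v) = (u == mate a v).
  by rewrite -(inj_eq (can_inj muK)) muK.
split=> [x|x|x u ux umx]; first by rewrite swapK muK swapK.
  by rewrite sE mun.
have h1 : swap u != swap x by rewrite sE swapK.
have h2 : swap u != mate a (swap x) by rewrite sE.
have h3 : mate a (swap u) != swap x by rewrite mE.
have h4 : mate a (swap u) != mate a (swap x) by rewrite mE muK.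
by have := pl _ _ h1 h2; rewrite -(sep_swap h1 h2) -(sep_swap h3 h4) !swapK.
Qed.

Lemma flip_Jones a : a \in Jones n -> flip a \in Jones n.
Proof. by move=> aJ; apply/of_matching_Jones/flip_planar. Qed.

Lemma mate_flip a x : a \in Jones n -> mate (flip a) x = swap (mate a (swap x)).
Proof. by move=> /flip_planar [fK fn _]; apply: mate_of. Qed.

Lemma flipK a : a \in Jones n -> flip (flip a) = a.
Proof.
move=> aJ; apply: Jones_ext => //; first by do 2!apply: flip_Jones.
by move=> x; rewrite !mate_flip ?flip_Jones // !swapK.
Qed.

Lemma compat_flip a f h : a \in Jones n -> compat (flip a) f h <-> compat a h f.
Proof.
move=> aJ; rewrite !compat_mate ?flip_Jones //.
have lE u : label f h (swap u) = label h f u by case: u.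
split=> E x; last by rewrite mate_flip // lE E -lE swapK.
by have := E (swap x); rewrite mate_flip // !lE swapK.
Qed.

Lemma flip_mul a b : a \in Jones n -> b \in Jones n ->
  flip (dmul a b) = dmul (flip b) (flip a).
Proof.
move=> aJ bJ; apply: compat_ext => f h.
apply: iff_trans (compat_flip f h (dmul_Jones aJ bJ)) _.
apply: iff_trans (compat_dmul a b h f) _; apply: iff_sym.
apply: iff_trans (compat_dmul (flip b) (flip a) f h) _.
have Ea g := compat_flip g h aJ; have Eb g := compat_flip f g bJ.
by split=> -[g fg gh]; exists g; [apply/Ea | apply/Eb | apply/Eb | apply/Ea].
Qed.

Lemma flip_hookd (i : 'I_n.-1) : flip (hookd i) = hookd i.
Proof.
apply: compat_ext => f h; rewrite compat_flip ?hookd_Jones // !compat_hookd.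
by split=> -[E1 E2 E3]; split=> // j j1 j2; rewrite E3.
Qed.

(** [a] has the block [{(lo i)', (hi i)'}]. *)
Definition lhook a (i : 'I_n.-1) : bool := mate a (inr (lo i)) == inr (hi i).

Lemma uhook_flip a i : a \in Jones n -> uhook (flip a) i = lhook a i.
Proof.
by move=> aJ; rewrite /uhook mate_flip // -[inl (hi i)]/(swap (inr _)) (inj_eq (can_inj (@swapK n))).
Qed.

Lemma lhook_flip a i : a \in Jones n -> lhook (flip a) i = uhook a i.
Proof. by move=> aJ; rewrite -uhook_flip ?flip_Jones // flipK. Qed.

Lemma rank_flip a : a \in Jones n -> rank (flip a) = rank a.
Proof.
move=> aJ; rewrite !rank_transv ?flip_Jones // -(card_transv' aJ).
by congr #|pred_of_set _|; apply/setP => i; rewrite !inE mate_flip //=; case: (mate a _).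
Qed.

(** Blocks of [b] inside the primed row survive in [dmul a b]. *)
Lemma mate_mul_primed a b i j : a \in Jones n -> b \in Jones n ->
  mate b (inr i) = inr j -> mate (dmul a b) (inr i) = inr j.
Proof.
move=> aJ bJ bij; elim/Jones_hookd_ind: a / aJ => [|k a aJ IH]; first by rewrite dmul1.
have abJ := dmul_Jones aJ bJ; rewrite -dmulA mate_hookd_mul // surgN //.
  by rewrite -(inj_eq (can_inj (mateK abJ))) mateK // IH.
by rewrite -(inj_eq (can_inj (mateK abJ))) mateK // IH.
Qed.

Lemma lhook_mul a b i : a \in Jones n -> b \in Jones n -> lhook b i -> lhook (dmul a b) i.
Proof. by move=> aJ bJ /eqP h; apply/eqP; apply: mate_mul_primed. Qed.

Lemma uhook_mul a b i : a \in Jones n -> b \in Jones n -> uhook a i -> uhook (dmul a b) i.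
Proof.
move=> aJ bJ ai; rewrite -lhook_flip ?dmul_Jones // flip_mul //.
by apply: lhook_mul; rewrite ?flip_Jones ?lhook_flip.
Qed.

Lemma rank_mulr a b : a \in Jones n -> b \in Jones n -> rank (dmul a b) <= rank b.
Proof.
move=> aJ bJ; rewrite !rank_transv ?dmul_Jones // -!card_transv' ?dmul_Jones //.
apply/subset_leq_card/subsetP => i; rewrite !inE; apply: contra.
by case E: (mate b _) => [//|j] _; rewrite (mate_mul_primed aJ bJ E).
Qed.

Lemma rank_mull a b : a \in Jones n -> b \in Jones n -> rank (dmul a b) <= rank a.
Proof.
move=> aJ bJ; rewrite -rank_flip ?dmul_Jones // -(rank_flip aJ) flip_mul //.
by apply: rank_mulr; apply: flip_Jones.
Qed.

Lemma rank_did : rank (did n) = n.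
Proof.
rewrite rank_transv ?did_Jones //; have -> : transv (did n) = setT.
  by apply/setP => i; rewrite !inE mate_did.
by rewrite cardsT card_ord.
Qed.

Lemma uhook_hi a i : a \in Jones n -> uhook a i -> mate a (inl (hi i)) = inl (lo i).
Proof. by move=> aJ /eqP <-; rewrite mateK. Qed.

Lemma uhook_transv a i : a \in Jones n -> uhook a i ->
  transv a \subset ~: [set lo i; hi i].
Proof.
move=> aJ ai; apply/subsetP => u; rewrite !inE; apply: contraL => /orP [] /eqP ->.
  by rewrite (eqP ai).
by rewrite (uhook_hi aJ ai).
Qed.

Lemma uhook_rank a i : a \in Jones n -> uhook a i -> rank a <= n - 2.
Proof.
move=> aJ ai; rewrite rank_transv //; apply: leq_trans (subset_leq_card (uhook_transv aJ ai)) _.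
by rewrite cardsCs setCK card_ord cards2 lo_hi.
Qed.

Lemma uhook2_rank a i j : a \in Jones n -> uhook a i -> uhook a j -> i != j ->
  rank a < n - 2.
Proof.
move=> aJ ai aj ij; rewrite rank_transv //.
have ji : lo j != lo i by rewrite -(inj_eq val_inj) /= eq_sym.
have jhi : lo j != hi i.
  apply/eqP => E; have := uhook_hi aJ ai; rewrite -E (eqP aj) => -[E2].
  by move: (congr1 (@nat_of_ord n) E) E2 => /=; lia.
have sub : transv a \subset ~: (lo j |: [set lo i; hi i]).
  rewrite setCU subsetI uhook_transv // andbT; apply: subset_trans (uhook_transv aJ aj) _.
  by rewrite setCS sub1set !inE eqxx.
have := subset_leq_card sub; rewrite [X in _ <= X]cardsCs setCK card_ord cardsU1 cards2 lo_hi.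
rewrite !inE negb_or ji jhi /=; have := ltn_ord (hi i); rewrite /=; have := ltn_ord j.
move: (lo_hi i) ji jhi; rewrite -!(inj_eq val_inj) /=; lia.
Qed.

Lemma rank_lt a : a \in Jones n -> a != did n -> rank a <= n - 2.
Proof. by move=> aJ /(exists_uhook aJ) [i]; apply: uhook_rank. Qed.

Lemma rank_hookd i : rank (@hookd n i) = n - 2.
Proof.
rewrite rank_transv ?hookd_Jones //; have -> : transv (hookd i) = ~: [set lo i; hi i].
  apply/setP => u; rewrite !inE mate_hookd; apply/idP/norP.
    by move=> h; split; apply: contraL h => /eqP ->; rewrite ?surgL ?surgR ?lo_hi_inl.
  by case=> h1 h2; rewrite surgN.
by rewrite cardsCs setCK card_ord cards2 lo_hi.
Qed.

Lemma lhook_hookd i : lhook (@hookd n i) i.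
Proof. by rewrite -uhook_flip ?hookd_Jones // flip_hookd uhook_hookd. Qed.

Lemma lhook_absorb i b : b \in Jones n -> lhook b i -> dmul b (hookd i) = b.
Proof.
move=> bJ bi; have fJ := flip_Jones bJ.
rewrite -[RHS](flipK bJ) -[flip b in RHS](@uhook_absorb n i) ?uhook_flip //.
by rewrite flip_mul ?hookd_Jones // flip_hookd flipK.
Qed.

(** A hook can be moved to any other position by a reversible left
    multiplication. *)
Lemma uhook_move (i j : 'I_n.-1) : exists w w', [/\ w \in Jones n, w' \in Jones n
  & forall a, a \in Jones n -> uhook a i -> uhook (dmul w a) j /\ dmul w' (dmul w a) = a].
Proof.
have [N] := ubnP ((i - j) + (j - i)); elim: N i => // N IH i ijN.
have [->|ij] := eqVneq i j.
  by exists (did n), (did n); split; rewrite ?did_Jones // => a aJ ai; rewrite !dmul1.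
have [k [ki kj]] : exists k : 'I_n.-1, ((k == i.+1 :> nat) || (i == k.+1 :> nat))
    /\ (k - j) + (j - k) < N.
  move: ij; rewrite -(inj_eq val_inj); case: ltngtP => //= ij _.
    have h : i.+1 < n.-1 by have := ltn_ord j; lia.
    by exists (Ordinal h); rewrite /= eqxx; split=> //; lia.
  have h : i.-1 < n.-1 by have := ltn_ord i; lia.
  by exists (Ordinal h); rewrite /=; split; lia.
have [w [w' [wJ w'J W]]] := IH k kj.
exists (dmul w (hookd k)), (dmul (hookd i) w'); split; rewrite ?dmul_Jones ?hookd_Jones //.
move=> a aJ ai; have kJ := hookd_mul_Jones k aJ.
have [W1 W2] := W _ kJ (uhook_hookd_mul k aJ).
by rewrite -!dmulA; split=> //; rewrite W2 uhook_slide.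
Qed.

Lemma hookd_uniq a j : a \in Jones n -> rank a = n - 2 -> uhook a j -> lhook a j ->
  a = hookd j.
Proof.
move=> aJ ra aj a'j.
have tE b : b \in Jones n -> rank b = n - 2 -> uhook b j -> transv b = ~: [set lo j; hi j].
  move=> bJ rb bj; apply/eqP; rewrite eqEcard uhook_transv // -rank_transv // rb.
  by rewrite cardsCs setCK card_ord cards2 lo_hi leqnn.
have ta := tE _ aJ ra aj.
have ta' : transv' a = transv a.
  rewrite ta -(tE (flip a)) ?rank_flip ?flip_Jones ?uhook_flip //.
  by apply/setP => i; rewrite !inE mate_flip //=; case: (mate a _).
have vert u : u != lo j -> u != hi j -> mate a (inl u) = inr u.
  by move=> u1 u2; apply: aligned_vertical => //; rewrite ta !inE negb_or u1.
apply: Jones_ext => //; first exact: hookd_Jones.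
move=> x; rewrite mate_hookd /surg.
have [->|x1] := eqVneq x; first exact/eqP.
have [->|x2] := eqVneq x; first exact: uhook_hi.
have [->|x3] := eqVneq x; first exact/eqP.
have [->|x4] := eqVneq x; first by rewrite /= -(eqP a'j) mateK.
case: x x1 x2 x3 x4 => u; rewrite ?inl_eq => u1 u2 u3 u4; first exact: vert.
by rewrite [RHS]/= -(vert u u3 u4) mateK.
Qed.

Lemma rank_move (i j : 'I_n.-1) : exists w w', [/\ w \in Jones n, w' \in Jones n
  & forall a, a \in Jones n -> rank a = n - 2 -> uhook a i -> lhook a j ->
    dmul w a = hookd j /\ a = dmul w' (hookd j)].
Proof.
have [w [w' [wJ w'J W]]] := uhook_move i j.
exists w, w'; split=> // a aJ ra ai aj; have [W1 W2] := W a aJ ai.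
have waJ := dmul_Jones wJ aJ.
have wa : dmul w a = hookd j.
  apply: hookd_uniq => //; last exact: lhook_mul.
  by apply/eqP; rewrite eqn_leq (uhook_rank waJ W1) -ra -{1}W2 rank_mulr.
by rewrite -wa W2.
Qed.

Lemma rank_coord_inj a b i j : a \in Jones n -> b \in Jones n ->
  rank a = n - 2 -> rank b = n - 2 ->
  uhook a i -> lhook a j -> uhook b i -> lhook b j -> a = b.
Proof.
move=> aJ bJ ra rb ai aj bi bj; have [w [w' [wJ w'J W]]] := rank_move i j.
by have [_ ->] := W a aJ ra ai aj; have [_ <-] := W b bJ rb bi bj.
Qed.

Lemma rank_coord_exists (i j : 'I_n.-1) :
  exists a, [/\ a \in Jones n, rank a = n - 2, uhook a i & lhook a j].
Proof.
have [w [w' [wJ w'J W]]] := uhook_move j i.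
have eJ := hookd_Jones j; have [W1 W2] := W _ eJ (uhook_hookd j).
exists (dmul w (hookd j)); split=> //; first exact: dmul_Jones.
  apply/eqP; rewrite eqn_leq (uhook_rank (dmul_Jones wJ eJ) W1) /=.
  by rewrite -(rank_hookd j) -{1}W2 rank_mulr ?dmul_Jones.
by apply: lhook_mul (lhook_hookd j).
Qed.

Lemma RclE a (i : 'I_n.-1) :
  (a \in Rcl i) = [&& a \in Jones n, rank a == n - 2 & uhook a i].
Proof. by rewrite inE; case: (boolP (a \in _)) => // aJ; rewrite Jones_blocks ?lo_hi_inl. Qed.

Lemma LclE a (i : 'I_n.-1) :
  (a \in Lcl i) = [&& a \in Jones n, rank a == n - 2 & lhook a i].
Proof.
rewrite inE; case: (boolP (a \in _)) => // aJ; rewrite Jones_blocks //.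
by rewrite inr_eq lo_hi.
Qed.

(** The element of rank [n - 2] with hooks at [i] in the unprimed row and at
    [j] in the primed row; it exists by [rank_coord_exists], so that the default
    value is immaterial. *)
Definition el (i j : 'I_n.-1) : dpart n := odflt (did n) [pick a in Rcl i :&: Lcl j].

Lemma elP i j : [/\ el i j \in Jones n, rank (el i j) = n - 2, uhook (el i j) i & lhook (el i j) j].
Proof.
rewrite /el; case: pickP => [a|].
  by rewrite inE RclE LclE => /andP [/and3P [? /eqP ? ?] /and3P [_ _ ?]].
have [a [aJ ra ai aj]] := rank_coord_exists i j.
by move/(_ a); rewrite inE RclE LclE aJ ra eqxx ai aj.
Qed.

Lemma el_Jones i j : el i j \in Jones n. Proof. by case: (elP i j). Qed.
Lemma rank_el i j : rank (el i j) = n - 2. Proof. by case: (elP i j). Qed.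
Lemma uhook_el i j : uhook (el i j) i. Proof. by case: (elP i j). Qed.
Lemma lhook_el i j : lhook (el i j) j. Proof. by case: (elP i j). Qed.

Lemma el_uniq a i j : a \in Jones n -> rank a = n - 2 -> uhook a i -> lhook a j -> a = el i j.
Proof. by move=> *; apply: rank_coord_inj (uhook_el i j) (lhook_el i j); rewrite ?el_Jones ?rank_el. Qed.

Lemma hookd_el i : hookd i = el i i.
Proof. by apply: el_uniq; rewrite ?hookd_Jones ?rank_hookd ?uhook_hookd ?lhook_hookd. Qed.

Lemma uhook_el_eq i j k : uhook (el i j) k = (k == i).
Proof.
apply/idP/eqP => [h|->]; last exact: uhook_el.
case: (eqVneq k i) => // ki.
by have := uhook2_rank (el_Jones i j) h (uhook_el i j) ki; rewrite rank_el ltnn.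
Qed.

Lemma flip_el i j : flip (el i j) = el j i.
Proof.
by apply: el_uniq; rewrite ?flip_Jones ?rank_flip ?uhook_flip ?lhook_flip ?el_Jones ?rank_el
  ?uhook_el ?lhook_el.
Qed.

Lemma lhook_el_eq i j k : lhook (el i j) k = (k == j).
Proof. by rewrite -uhook_flip ?el_Jones // flip_el uhook_el_eq. Qed.

Lemma el_inj i j k l : el i j = el k l -> i = k /\ j = l.
Proof.
move=> E; split; apply/eqP; first by rewrite -(uhook_el_eq k l) -E uhook_el.
by rewrite -(lhook_el_eq k l) -E lhook_el.
Qed.

Lemma exists_el a : 2 <= n -> a \in Jones n -> rank a = n - 2 -> exists i j, a = el i j.
Proof.
move=> n2 aJ ra; have fJ := flip_Jones aJ.
have neq b : rank b = n - 2 -> b != did n.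
  by move=> rb; apply/eqP => E; move: rb; rewrite E rank_did; lia.
have [i ai] := exists_uhook aJ (neq _ ra).
have [j aj] : exists j, uhook (flip a) j by apply: exists_uhook => //; apply: neq; rewrite rank_flip.
by exists i, j; apply: el_uniq; rewrite -?uhook_flip.
Qed.

Lemma el_mul i j k l : near j k -> dmul (el i j) (el k l) = el i l.
Proof.
move=> jk; have xJ := el_Jones i j; have yJ := el_Jones k l; have xyJ := dmul_Jones xJ yJ.
apply: el_uniq => //; last 2 first.
- by apply: uhook_mul (uhook_el i j).
- by apply: lhook_mul (lhook_el k l).
apply/eqP; rewrite eqn_leq -{1}(rank_el i j) rank_mull //=.
(* Left multiplication by [w] turns the product into [hookd j * el k l], of
   which [el k l] is a left multiple; so no rank is lost. *)
have [w [w' [wJ _ W]]] := rank_move i j.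
have [E _] := W _ xJ (rank_el i j) (uhook_el i j) (lhook_el i j).
apply: leq_trans (rank_mulr wJ xyJ); rewrite dmulA E.
have [jke|nejk] := eqVneq j k; first by rewrite uhook_absorb // ?rank_el // jke uhook_el.
have eyJ := hookd_mul_Jones j yJ.
have kj : (j == k.+1 :> nat) || (k == j.+1 :> nat).
  by move: jk nejk; rewrite -(inj_eq val_inj) /near /=; lia.
have := rank_mulr (hookd_Jones k) eyJ.
by rewrite (uhook_slide yJ (uhook_el k l) kj) rank_el.
Qed.

Lemma el_mul_low i j k l : ~~ near j k -> rank (dmul (el i j) (el k l)) < n - 2.
Proof.
move=> jk; have xJ := el_Jones i j; have yJ := el_Jones k l.
rewrite -(lhook_absorb xJ (lhook_el i j)) -dmulA.
have eyJ := hookd_mul_Jones j yJ.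
apply: leq_ltn_trans (rank_mulr xJ eyJ) _.
apply: (uhook2_rank eyJ (uhook_hookd_mul j yJ) (j := k)); last first.
  by apply: contraNneq jk => ->; rewrite /near leqnSn.
have yk := uhook_el k l; have mK := mateK yJ.
have hyk := uhook_hi yJ yk.
rewrite /uhook mate_hookd_mul // surgN ?(eqP yk) //.
- by move: jk; rewrite -(inj_eq (@pos_inj n)) /near /=; lia.
- by move: jk; rewrite -(inj_eq (@pos_inj n)) /near /=; lia.
- rewrite -(inj_eq (can_inj mK)) mK (eqP yk).
  by move: jk; rewrite -(inj_eq (@pos_inj n)) /near /=; lia.
rewrite -(inj_eq (can_inj mK)) mK (eqP yk).
by move: jk; rewrite -(inj_eq (@pos_inj n)) /near /=; lia.
Qed.

End RankStructure.

(** * Monoids with a rectangular second layer *)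

(** A monoid [S] with identity [e], in which [e] is not a product of other
    elements; it is the disjoint union of [e], a layer of pairwise distinct
    elements [el i j] and an ideal [K]. The product of [el i j] and [el k l] is
    [el i l] if [near j k] holds, and lies in [K] otherwise. The monoid is
    generated by [e] and the layer. *)
Record layered (T : finType) (mul : T -> T -> T) (S : {set T}) (e : T)
    (K : {set T}) (m : nat) (near : rel 'I_m) (el : 'I_m -> 'I_m -> T) : Prop :=
  Layered {
    lay_mulS : forall a b, a \in S -> b \in S -> mul a b \in S;
    lay_mulA : forall a b c, mul a (mul b c) = mul (mul a b) c;
    lay_mul1 : forall a, mul e a = a;
    lay_mul_1 : forall a, mul a e = a;
    lay_eS : e \in S;
    lay_elS : forall i j, el i j \in S;
    lay_KS : K \subset S;
    lay_split : forall a, a \in S ->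
      [\/ a = e, exists i j, a = el i j | a \in K];
    lay_e_el : forall i j, el i j != e;
    lay_eK : e \notin K;
    lay_elK : forall i j, el i j \notin K;
    lay_el_inj : forall i j k l, el i j = el k l -> i = k /\ j = l;
    lay_indec : forall a b, a \in S -> b \in S -> mul a b = e -> a = e /\ b = e;
    lay_Kl : forall a b, a \in S -> b \in K -> mul a b \in K;
    lay_Kr : forall a b, a \in K -> b \in S -> mul a b \in K;
    lay_near : forall i j k l, near j k -> mul (el i j) (el k l) = el i l;
    lay_far : forall i j k l, ~~ near j k -> mul (el i j) (el k l) \in K;
    lay_gen : forall M : {set T}, (forall a b, a \in M -> b \in M -> mul a b \in M) ->
      e \in M -> (forall i j, el i j \in M) -> S \subset M;
    near_refl : reflexive near;
    near_sym : symmetric near }.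

(** The opposite monoid is again layered; this exchanges L- and R-classes. *)
Lemma layered_dual (T : finType) (mul : T -> T -> T) (S : {set T}) (e : T)
    (K : {set T}) (m : nat) (near : rel 'I_m) (el : 'I_m -> 'I_m -> T) :
  layered mul S e K near el ->
  layered (fun a b => mul b a) S e K near (fun i j => el j i).
Proof.
case=> H1 H2 H3 H4 H5 H6 H7 H8 H9 H10 H11 H12 H13 H14 H15 H16 H17 H18 H19 H20.
split=> //.
- by move=> a b aS bS; apply: H1.
- by move=> a /H8 [->|[i [j ->]]|?]; [constructor 1|constructor 2; exists j, i|constructor 3].
- by move=> i j k l /H12 [].
- by move=> a b aS bS /H13 [].
- by move=> a b aS bK; apply: H15.
- by move=> a b aS bK; apply: H14.
- by move=> i j k l jk; apply: H16; rewrite H20.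
- by move=> i j k l jk; apply: H17; rewrite H20.
by move=> M MM eM elM; apply: H18 => // a b aM bM; apply: MM.
Qed.

Section Layered.
Context (T : finType) (mul : T -> T -> T) (S : {set T}) (e : T).
Context (K : {set T}) (m : nat) (near : rel 'I_m) (el : 'I_m -> 'I_m -> T).
Context (H : layered mul S e K near el).
Implicit Types (a b c : T) (i j k l : 'I_m) (M : {set T}) (I : {set 'I_m + 'I_m}).

(** The elements [el i j], those with given first index, and those with given
    second index; by [L_class_el] and duality the latter two are the R- and
    L-classes of the layer. *)
Definition layer : {set T} := [set el p.1 p.2 | p : 'I_m * 'I_m].
Definition Rlay i : {set T} := [set el i j | j : 'I_m].
Definition Llay j : {set T} := [set el i j | i : 'I_m].

Lemma layerP a : reflect (exists i j, a = el i j) (a \in layer).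
Proof.
apply: (iffP imsetP) => [[[i j] _ ->]|[i [j ->]]]; first by exists i, j.
by exists (i, j).
Qed.

Lemma el_layer i j : el i j \in layer. Proof. by apply/layerP; exists i, j. Qed.

Lemma mem_Llay i j l : (el i j \in Llay l) = (j == l).
Proof.
apply/imsetP/eqP => [[k _ /(lay_el_inj H) []] // | ->]; by exists i.
Qed.

Lemma mem_Rlay i j k : (el i j \in Rlay k) = (i == k).
Proof.
apply/imsetP/eqP => [[l _ /(lay_el_inj H) []] // | ->]; by exists j.
Qed.

Lemma Llay_sub j : Llay j \subset layer.
Proof. by apply/subsetP => a /imsetP [i _ ->]; apply: el_layer. Qed.

Lemma Rlay_sub i : Rlay i \subset layer.
Proof. by apply/subsetP => a /imsetP [j _ ->]; apply: el_layer. Qed.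

Lemma layer_sub : layer \subset S.
Proof. by apply/subsetP => a /layerP [i [j ->]]; apply: (lay_elS H _ _). Qed.

Lemma e_notin_layer : e \notin layer.
Proof. by apply/layerP => -[i [j E]]; have := lay_e_el H i j; rewrite -E eqxx. Qed.

Lemma K_notin_layer a : a \in K -> a \notin layer.
Proof. by move=> aK; apply/layerP => -[i [j E]]; have := lay_elK H i j; rewrite -E aK. Qed.

(** * Green's classes of the second layer *)

Lemma left_idealP a b : a \in S ->
  reflect (exists2 s, s \in S & b = mul s a) (b \in left_ideal mul S a).
Proof.
move=> aS; apply: (iffP setU1P) => [[->|/imsetP [s sS ->]]|[s sS ->]].
- by exists e; rewrite ?(lay_eS H) ?(lay_mul1 H).
- by exists s.
by right; apply: imset_f.
Qed.

Lemma left_ideal_sub a b : a \in S -> b \in left_ideal mul S a ->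
  left_ideal mul S b \subset left_ideal mul S a.
Proof.
move=> aS /(left_idealP _ aS) [s sS ->]; apply/subsetP => c.
case/(left_idealP _ (lay_mulS H sS aS)) => t tS ->; apply/left_idealP => //.
by exists (mul t s); rewrite ?(lay_mulS H) ?(lay_mulA H).
Qed.

Lemma mul_el_el a i j k l : a \in S -> mul a (el k l) = el i j -> l = j.
Proof.
move=> aS E; case: (lay_split H aS) => [ae|[u [v auv]]|aK].
- by move: E; rewrite ae (lay_mul1 H) => /(lay_el_inj H) [].
- move: E; rewrite auv; case: (boolP (near v k)) => vk.
    by rewrite (lay_near H) // => /(lay_el_inj H) [].
  by move=> E; have := lay_far H u l vk; rewrite E (negbTE (lay_elK H _ _)).
by have := lay_Kr H aK (lay_elS H k l); rewrite E (negbTE (lay_elK H _ _)).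
Qed.

Lemma greenL_el i j b : b \in S -> greenL mul S (el i j) b = (b \in Llay j).
Proof.
move=> bS; apply/eqP/idP => [E|/imsetP [k _ ->]].
  have /(left_idealP _ bS) [s sS Es] : el i j \in left_ideal mul S b.
    by rewrite -E; apply/setU1P; left.
  case: (lay_split H bS) => [be|[u [v buv]]|bK].
  - have : b \in left_ideal mul S (el i j) by rewrite E; apply/setU1P; left.
    case/(left_idealP _ (lay_elS H i j)) => t tS; rewrite be => /esym /(lay_indec H tS (lay_elS H i j)) [_].
    by move/eqP; rewrite (negbTE (lay_e_el H _ _)).
  - rewrite buv in Es *; by rewrite (mul_el_el sS (esym Es)) mem_Llay.
  by have := lay_Kl H sS bK; rewrite -Es (negbTE (lay_elK H _ _)).
have sub u v : left_ideal mul S (el u j) \subset left_ideal mul S (el v j).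
  apply: left_ideal_sub (lay_elS H _ _) _; apply/left_idealP; first exact: (lay_elS H _ _).
  by exists (el u v); rewrite ?(lay_elS H) // (lay_near H) // (near_refl H).
by apply/eqP; rewrite eqEsubset !sub.
Qed.

Lemma L_class_el i j : [set b in S | greenL mul S (el i j) b] = Llay j.
Proof.
apply/setP => b; rewrite inE; case: (boolP (b \in S)) => bS; first exact: greenL_el.
by apply/esym/negbTE; apply: contra bS => /(subsetP (Llay_sub _)) /(subsetP layer_sub).
Qed.

Lemma Llay_class j : Llay j \in L_classes mul S.
Proof. by apply/imsetP; exists (el j j); rewrite ?(lay_elS H) // L_class_el. Qed.

Lemma L_class_layer L i j : L \in L_classes mul S -> el i j \in L -> L = Llay j.
Proof.
case/imsetP => a aS ->; rewrite inE => /andP [elS /eqP E].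
rewrite -(L_class_el i j); apply/setP => b; rewrite !inE /greenL.
by rewrite E.
Qed.

Lemma two_sided_idealP a b : a \in S ->
  reflect (exists s t, [/\ s \in S, t \in S & b = mul s (mul a t)])
    (b \in two_sided_ideal mul S a).
Proof.
move=> aS; apply: (iffP setUP) => [[/(left_idealP _ aS) [s sS ->]|]|[s [t [sS tS ->]]]].
- by exists s, e; rewrite (lay_eS H) (lay_mul_1 H).
- case/bigcupP => t tS /(left_idealP _ (lay_mulS H aS tS)) [s sS ->].
  by exists s, t.
right; apply/bigcupP; exists t => //; apply/left_idealP; first exact: (lay_mulS H).
by exists s.
Qed.

Lemma two_sided_ideal_refl a : a \in two_sided_ideal mul S a.
Proof. by apply/setUP; left; apply/setU1P; left. Qed.

Lemma two_sided_ideal_sub a b : a \in S -> b \in S -> b \in two_sided_ideal mul S a ->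
  two_sided_ideal mul S b \subset two_sided_ideal mul S a.
Proof.
move=> aS bS /(two_sided_idealP _ aS) [s [t [sS tS Eb]]]; apply/subsetP => c.
case/(two_sided_idealP _ bS) => u [v [uS vS ->]]; apply/two_sided_idealP => //.
by exists (mul u s), (mul t v); rewrite Eb !(lay_mulS H) // !(lay_mulA H).
Qed.

Lemma greenJ_el i j b : b \in S -> greenJ mul S (el i j) b = (b \in layer).
Proof.
move=> bS; have xS := lay_elS H i j; apply/eqP/idP => [E|/layerP [k [l ->]]].
  have /(two_sided_idealP _ bS) [s [t [sS tS Es]]] : el i j \in two_sided_ideal mul S b.
    by rewrite -E two_sided_ideal_refl.
  case: (lay_split H bS) => [be|[u [v buv]]|bK]; last 2 first.
  - by rewrite buv el_layer.
  - have := lay_Kl H sS (lay_Kr H bK tS).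
    by rewrite -Es (negbTE (lay_elK H _ _)).
  have : b \in two_sided_ideal mul S (el i j) by rewrite E two_sided_ideal_refl.
  case/(two_sided_idealP _ xS) => u [v [uS vS]]; rewrite be => /esym.
  case/(lay_indec H uS (lay_mulS H xS vS)) => _ /(lay_indec H xS vS) [xe].
  by have := lay_e_el H i j; rewrite xe eqxx.
have sub p q u v : two_sided_ideal mul S (el p q) \subset two_sided_ideal mul S (el u v).
  apply: two_sided_ideal_sub; rewrite ?(lay_elS H) //.
  apply/two_sided_idealP; rewrite ?(lay_elS H) //.
  by exists (el p u), (el v q); rewrite !(lay_elS H) !(lay_near H) ?(near_refl H).
by apply/eqP; rewrite eqEsubset !sub.
Qed.

Lemma greenJ_e b : b \in S -> greenJ mul S e b = (b == e).
Proof.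
move=> bS; apply/eqP/eqP => [E|-> //].
have : e \in two_sided_ideal mul S b by rewrite -E two_sided_ideal_refl.
case/(two_sided_idealP _ bS) => u [v [uS vS]] /esym.
by case/(lay_indec H uS (lay_mulS H bS vS)) => _ /(lay_indec H bS vS) [].
Qed.

Lemma layer_arises M : 0 < m -> S :\: M \subset layer ->
  arises_from_regular mul S M layer.
Proof.
move=> m0 SM; pose o := Ordinal m0; split=> //.
  apply/imsetP; exists (el o o); first exact: (lay_elS H _ _).
  apply/setP => b; rewrite inE; case: (boolP (b \in S)) => bS; first by rewrite greenJ_el.
  by apply/negbTE; apply: contra bS => /(subsetP layer_sub).
apply/forall_inP => a /layerP [i [j ->]]; apply/exists_inP; exists (el j i).
  exact: (lay_elS H _ _).
by rewrite !(lay_near H) ?(near_refl H).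
Qed.

Lemma e_arises M : S :\: M \subset [set e] -> arises_from_regular mul S M [set e].
Proof.
move=> SM; split=> //.
  apply/imsetP; exists e; first exact: (lay_eS H).
  apply/setP => b; rewrite !inE; case: (boolP (b \in S)) => bS; first by rewrite greenJ_e.
  by apply/negbTE; apply: contraNneq bS => ->; apply: (lay_eS H).
apply/forall_inP => a /set1P ->; apply/exists_inP; exists e; first exact: (lay_eS H).
by rewrite !(lay_mul1 H).
Qed.

(** The intersection of an L-class and an R-class of the second layer is a
    single element, and a group when this element is idempotent. *)
Lemma is_group_layer i j : is_group mul (Llay j :&: Rlay i) = near j i.
Proof.
have E x : (x \in Llay j :&: Rlay i) = (x == el i j).
  rewrite inE; apply/andP/eqP => [[/imsetP [k _ ->]]|->].
    by rewrite mem_Rlay => /eqP ->.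
  by rewrite mem_Llay mem_Rlay !eqxx.
apply/idP/idP => [/and3P [mc _ _] | ji].
  have elE : el i j \in Llay j :&: Rlay i by rewrite E.
  have /forall_inP /(_ _ elE) /forall_inP /(_ _ elE) := mc.
  rewrite E; apply: contraLR => ji; apply: contraTneq (lay_far H i j ji) => ->.
  exact: (lay_elK H _ _).
have idem : mul (el i j) (el i j) = el i j by rewrite (lay_near H).
apply/and3P; split.
- apply/forall_inP => a; rewrite E => /eqP ->; apply/forall_inP => b; rewrite E => /eqP ->.
  by rewrite idem E.
- do 3!(apply/forall_inP => ? _); by rewrite (lay_mulA H).
apply/exists_inP; exists (el i j); first by rewrite E.
apply/forall_inP => a; rewrite E => /eqP ->; rewrite idem eqxx /=.
by apply/exists_inP; exists (el i j); rewrite ?E ?idem ?eqxx.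
Qed.

(** * Maximal independent sets *)

(** The bipartite graph of which Delta is an instance: [inl j] stands for the
    L-class [Llay j] and [inr i] for the R-class [Rlay i]. *)
Definition near_graph : rel ('I_m + 'I_m) := fun u v =>
  match u, v with
  | inl j, inr i => near j i
  | inr i, inl j => near j i
  | _, _ => false
  end.

Definition all_inl : {set 'I_m + 'I_m} := [set inl i | i : 'I_m].
Definition all_inr : {set 'I_m + 'I_m} := [set inr i | i : 'I_m].

Lemma in_all_inl (v : 'I_m + 'I_m) : (v \in all_inl) = (if v is inl _ then true else false).
Proof. by case: v => i; apply/imsetP; [exists i | case]. Qed.

Lemma in_all_inr (v : 'I_m + 'I_m) : (v \in all_inr) = (if v is inr _ then true else false).
Proof. by case: v => i; apply/imsetP; [case | exists i]. Qed.

Lemma independentP I :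
  reflect (forall i j, inl j \in I -> inr i \in I -> ~~ near j i)
          (independent near_graph I).
Proof.
apply: (iffP forall_inP) => [ind i j jI iI | ind [i|i] iI].
- by have /forall_inP /(_ _ iI) := ind _ jI.
- by apply/forall_inP => -[j|j] jI //=; apply: ind.
by apply/forall_inP => -[j|j] jI //=; apply: ind.
Qed.

Lemma maximal_independentP I :
  maximal_independent near_graph I <->
    (forall j, inl j \in I <-> forall i, near j i -> inr i \notin I) /\
    (forall i, inr i \in I <-> forall j, near j i -> inl j \notin I).
Proof.
split=> [/maxsetP [/independentP ind mx] | [HL HR]].
  split=> x; split=> [xI y xy | xN].
  - by apply: contraL xy => yI; apply: ind.
  - rewrite -(mx (inl x |: I)) ?setU11 ?subsetU1 //.
    apply/independentP => i j; rewrite !inE /= => /orP [/eqP [->] iI|jI iI].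
      by apply: contraL iI; apply: xN.
    exact: ind.
  - by apply: contraL xy => yI; apply: ind.
  rewrite -(mx (inr x |: I)) ?setU11 ?subsetU1 //.
  apply/independentP => i j; rewrite !inE /= => jI /orP [/eqP [->]|iI].
    by apply: contraL jI; apply: xN.
  exact: ind.
apply/maxsetP; split.
  by apply/independentP => i j /HL h iI; apply: contraL iI; apply: h.
move=> B /independentP ind IB; apply/eqP; rewrite eqEsubset IB andbT.
apply/subsetP => -[j|i] vB.
  apply/HL => i ji; apply: contraL ji => iI; apply: ind => //; exact: (subsetP IB).
apply/HR => j ji; apply: contraL ji => jI; apply: ind => //; exact: (subsetP IB).
Qed.

(** The index sets of the maximal subsemigroups that contain [e]: maximal
    independent sets that are not bicomponents, and bicomponents with one vertex
    removed. *)
Definition crit_b : {set {set 'I_m + 'I_m}} :=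
  [set I | maximal_independent near_graph I && ~~ ((I == all_inl) || (I == all_inr))].
Definition crit_c : {set {set 'I_m + 'I_m}} := [set all_inl :\ inl l | l : 'I_m].
Definition crit_d : {set {set 'I_m + 'I_m}} := [set all_inr :\ inr i | i : 'I_m].
Definition crit : {set {set 'I_m + 'I_m}} := crit_b :|: crit_c :|: crit_d.

(** The set [I] is independent, both its sides are incomplete, and every vertex
    missing from one side has a neighbour in the other side or is the only one
    missing from its side. This makes [sub_of I] below a maximal subsemigroup. *)
Record saturated I : Prop := Saturated {
  sat_ind : forall i j, inl j \in I -> inr i \in I -> ~~ near j i;
  sat_r : exists i, inr i \notin I;
  sat_l : exists j, inl j \notin I;
  sat_near_r : forall i, inr i \notin I ->
    (exists2 b, inl b \in I & near b i) \/ (forall k, inr k \notin I -> k = i);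
  sat_near_l : forall j, inl j \notin I ->
    (exists2 a, inr a \in I & near j a) \/ (forall l, inl l \notin I -> l = j) }.

Context (near_other : forall i, exists2 j, j != i & near j i).

Lemma near_avoid (l i : 'I_m) : exists2 b, b != l & near b i.
Proof.
have [->|il] := eqVneq i l; first exact: near_other.
by exists i => //; apply: (near_refl H _).
Qed.

Lemma crit_b_saturated I : I \in crit_b -> saturated I.
Proof.
rewrite inE => /andP [/maximal_independentP [HL HR]]; rewrite negb_or => /andP [nL nR].
split.
- by move=> i j /HL h iI; apply: contraL iI; apply: h.
- apply/existsP; rewrite -negb_forall; apply: contra nR => /forallP h.
  apply/eqP/setP => -[j|i]; rewrite in_all_inr; last exact: h.
  by apply/negbTE/negP => /HL /(_ j (near_refl H j)); rewrite h.
- apply/existsP; rewrite -negb_forall; apply: contra nL => /forallP h.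
  apply/eqP/setP => -[j|i]; rewrite in_all_inl; first exact: h.
  by apply/negbTE/negP => /HR /(_ i (near_refl H i)); rewrite h.
- move=> i iI; left; apply/exists_inP; apply: contraNT iI; rewrite negb_exists_in => /forall_inP h.
  by apply/HR => j ji; apply/negP => /h; rewrite ji.
move=> j jI; left; apply/exists_inP; apply: contraNT jI; rewrite negb_exists_in => /forall_inP h.
by apply/HL => i ji; apply/negP => /h; rewrite ji.
Qed.

Lemma crit_c_saturated I : I \in crit_c -> saturated I.
Proof.
case/imsetP => l0 _ ->.
have Il j : (inl j \in all_inl :\ inl l0) = (j != l0) by rewrite !inE in_all_inl andbT.
have Ir i : (inr i \in all_inl :\ inl l0) = false by rewrite !inE in_all_inl.
split.
- by move=> i j; rewrite Ir.
- by exists l0; rewrite Ir.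
- by exists l0; rewrite Il eqxx.
- by move=> i _; left; have [b bl bi] := near_avoid l0 i; exists b; rewrite ?Il.
by move=> j; rewrite Il negbK => /eqP ->; right=> l; rewrite Il negbK => /eqP.
Qed.

Lemma crit_d_saturated I : I \in crit_d -> saturated I.
Proof.
case/imsetP => l0 _ ->.
have Ir j : (inr j \in all_inr :\ inr l0) = (j != l0) by rewrite !inE in_all_inr andbT.
have Il i : (inl i \in all_inr :\ inr l0) = false by rewrite !inE in_all_inr.
split.
- by move=> i j; rewrite Il.
- by exists l0; rewrite Ir eqxx.
- by exists l0; rewrite Il.
- by move=> i; rewrite Ir negbK => /eqP ->; right=> l; rewrite Ir negbK => /eqP.
by move=> i _; left; have [b bl bi] := near_avoid l0 i; exists b; rewrite ?Ir // (near_sym H).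
Qed.

Lemma crit_saturated I : I \in crit -> saturated I.
Proof.
case/setUP => [/setUP [] |] h.
- exact: crit_b_saturated.
- exact: crit_c_saturated.
exact: crit_d_saturated.
Qed.

(** * Maximal subsemigroups *)

(** The class represented by a vertex. *)
Definition vlay (v : 'I_m + 'I_m) : {set T} :=
  match v with inl j => Llay j | inr i => Rlay i end.

(** The elements outside the layer and the classes belonging to [I]. *)
Definition sub_of I : {set T} := (S :\: layer) :|: \bigcup_(v in I) vlay v.

Lemma el_sub_of I i j : (el i j \in sub_of I) = (inl j \in I) || (inr i \in I).
Proof.
rewrite !inE el_layer /=; apply/bigcupP/orP => [[[l|k] vI /=]|[jI|iI]].
- by rewrite mem_Llay => /eqP ->; left.
- by rewrite mem_Rlay => /eqP ->; right.
- by exists (inl j); rewrite //= mem_Llay.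
by exists (inr i); rewrite //= mem_Rlay.
Qed.

Lemma sub_of_sub I : sub_of I \subset S.
Proof.
rewrite subUset subsetDl; apply/bigcupsP => -[j|i] _; apply: subset_trans layer_sub.
  exact: Llay_sub.
exact: Rlay_sub.
Qed.

Lemma sub_of_out I a : a \in S -> a \notin layer -> a \in sub_of I.
Proof. by move=> aS aJ; rewrite !inE aS aJ. Qed.

Lemma e_sub_of I : e \in sub_of I.
Proof. by apply: sub_of_out; [exact: (lay_eS H) | exact: e_notin_layer]. Qed.

Lemma sub_of_proper I : saturated I -> proper_subsemigroup mul S (sub_of I).
Proof.
move=> sI; apply/and3P; split.
- apply/properP; split; first exact: sub_of_sub.
  have [i iI] := sat_r sI; have [j jI] := sat_l sI.
  by exists (el i j); [exact: (lay_elS H _ _) | rewrite el_sub_of negb_or iI jI].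
- by apply/set0Pn; exists e; apply: e_sub_of.
have inS := subsetP (sub_of_sub I).
apply/forall_inP => a aI; apply/forall_inP => b bI; have aS := inS _ aI; have bS := inS _ bI.
have out x : x \in K -> x \in sub_of I.
  by move=> xK; apply: sub_of_out; [exact: (subsetP (lay_KS H)) | exact: K_notin_layer].
case: (lay_split H aS) aI => [-> _|[i [j ->]]|aK _]; first by rewrite (lay_mul1 H).
  case: (lay_split H bS) bI => [-> _|[k [l ->]]|bK _]; first by rewrite (lay_mul_1 H).
    rewrite !el_sub_of => kl ij; case: (boolP (near j k)) => jk; last first.
      by apply: out; exact: (lay_far H i l jk).
    rewrite (lay_near H) // el_sub_of.
    case/orP: ij => [jI|->]; last by rewrite orbT.
    case/orP: kl => [->//|kI].
    by have := sat_ind sI jI kI; rewrite jk.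
  by move=> _; apply: out; apply: (lay_Kl H (lay_elS H _ _) bK).
by apply: out; apply: (lay_Kr H aK bS).
Qed.

Lemma sub_of_maximal I : saturated I -> maximal_subsemigroup mul S (sub_of I).
Proof.
move=> sI; apply/maxsetP; split; first exact: sub_of_proper.
move=> B /and3P [/properP [BS [z zS zB]] _ /forall_inP Bmul] IB.
have {}Bmul a b : a \in B -> b \in B -> mul a b \in B.
  by move=> aB bB; have /forall_inP := Bmul a aB; apply.
apply/eqP; rewrite eqEsubset IB andbT; apply/subsetP => a aB; apply: contraNT zB => aI.
have /layerP [i [j aij]] : a \in layer.
  by apply: contraNT aI => aJ; apply: sub_of_out => //; apply: (subsetP BS).
move: aI; rewrite aij el_sub_of negb_or => /andP [jI iI]; rewrite aij in aB.
have inB k l : (inl l \in I) || (inr k \in I) -> el k l \in B.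
  by move=> h; apply: (subsetP IB); rewrite el_sub_of.
suff allB k l : el k l \in B.
  apply: (subsetP (lay_gen H Bmul _ allB)) => //; apply: (subsetP IB); exact: e_sub_of.
case: (boolP ((inl l \in I) || (inr k \in I))) => [/inB //|]; rewrite negb_or => /andP [lI kI].
have kjB : el k j \in B.
  case: (sat_near_r sI iI) => [[b bI bi]|/(_ k kI) -> //].
  by rewrite -(lay_near H k j bi); apply: Bmul => //; apply: inB; rewrite bI.
case: (sat_near_l sI jI) => [[b bI bi]|/(_ l lI) -> //].
by rewrite -(lay_near H k l bi); apply: Bmul => //; apply: inB; rewrite bI orbT.
Qed.

Lemma sub_of_inj I I' : saturated I -> saturated I' -> sub_of I = sub_of I' -> I = I'.
Proof.
have sub A B : saturated A -> saturated B -> sub_of A = sub_of B -> A \subset B.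
  move=> sA sB E; apply/subsetP => -[j|i] vA.
    have [i iB] := sat_r sB; have : el i j \in sub_of B by rewrite -E el_sub_of vA.
    by rewrite el_sub_of (negbTE iB) orbF.
  have [j jB] := sat_l sB; have : el i j \in sub_of B by rewrite -E el_sub_of vA orbT.
  by rewrite el_sub_of (negbTE jB).
by move=> sI sI' E; apply/eqP; rewrite eqEsubset !sub.
Qed.

Lemma minus_e_maximal : 0 < m -> maximal_subsemigroup mul S (S :\ e).
Proof.
move=> m0; pose o := Ordinal m0; apply/maxsetP; split.
  apply/and3P; split.
  - by apply: properD1; apply: (lay_eS H).
  - by apply/set0Pn; exists (el o o); rewrite !inE (lay_e_el H) (lay_elS H).
  apply/forall_inP => a /setD1P [ae aS]; apply/forall_inP => b /setD1P [be bS].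
  apply/setD1P; split; last exact: (lay_mulS H).
  by apply: contraNneq ae => /(lay_indec H aS bS) [-> _].
move=> B /andP [BS _] SB; apply/eqP; rewrite eqEsubset SB andbT.
apply/subsetP => a aB; rewrite !inE (subsetP (proper_sub BS) _ aB) andbT.
apply: contraTneq BS => ae; rewrite properE negb_and; apply/orP; right; rewrite negbK.
apply/subsetP => x xS; have [->|xe] := eqVneq x e; first by rewrite -ae.
by apply: (subsetP SB); rewrite !inE xe.
Qed.

(** Let [el p q] be missing from [M]. If [M] meets every R- and L-class of the
    layer, the required maximal independent set consists of the set [A] of rows
    [i] without neighbour among the columns that [M] meets in row [p], and of the
    set [B] of columns without neighbour in [A]. *)
Lemma proper_sub_crit M : proper_subsemigroup mul S M -> e \in M ->
  exists2 I, I \in crit & M \subset sub_of I.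
Proof.
case/and3P => /properP [MS [z zS zM]] _ /forall_inP Mmul eM.
have {}Mmul a b : a \in M -> b \in M -> mul a b \in M.
  by move=> aM bM; have /forall_inP := Mmul a aM; apply.
have sub I : (forall i j, el i j \in M -> (inl j \in I) || (inr i \in I)) -> M \subset sub_of I.
  move=> h; apply/subsetP => a aM; case: (boolP (a \in layer)) => [/layerP [i [j aij]]|aJ].
    by rewrite aij el_sub_of h // -aij.
  by apply: sub_of_out => //; apply: (subsetP MS).
(* Otherwise generation by [e] and the layer would make [M] all of [S]. *)
have [p [q pq]] : exists p q, el p q \notin M.
  case: (boolP [exists p, exists q, el p q \notin M]) => [/existsP [p /existsP [q pq]]|].
    by exists p, q.
  rewrite negb_exists => /forallP h; case/negP: zM; apply: (subsetP (lay_gen H Mmul eM _)) zS.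
  by move=> i j; have := h i; rewrite negb_exists => /forallP /(_ j); rewrite negbK.
case: (boolP [exists l, forall i, el i l \notin M]) => [/existsP [l /forallP h]|].
  exists (all_inl :\ inl l); first by rewrite !inE; apply/orP; left; apply/orP; right; apply: imset_f.
  apply: sub => i j ijM; rewrite !inE in_all_inl andbT; apply/orP; left.
  by apply: contraTneq ijM => -[->].
rewrite negb_exists => /forallP cM.
case: (boolP [exists k, forall j, el k j \notin M]) => [/existsP [k /forallP h]|].
  exists (all_inr :\ inr k); first by rewrite !inE; apply/orP; right; apply: imset_f.
  apply: sub => i j ijM; rewrite !inE !in_all_inr andbT; apply/orP; right.
  by apply: contraTneq ijM => -[->].
rewrite negb_exists => /forallP rM.
pose A := [set i | [forall j, near j i ==> (el p j \notin M)]].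
pose B := [set j | [forall i, near j i ==> (i \notin A)]].
pose I : {set 'I_m + 'I_m} := [set v | match v with inl j => j \in B | inr i => i \in A end].
have AP i : reflect (forall j, near j i -> el p j \notin M) (i \in A).
  by rewrite inE; apply: (iffP forallP) => h j; apply/implyP; apply: h.
have BP j : reflect (forall i, near j i -> i \notin A) (j \in B).
  by rewrite inE; apply: (iffP forallP) => h i; apply/implyP; apply: h.
have Il j : (inl j \in I) = (j \in B) by rewrite inE.
have Ir i : (inr i \in I) = (i \in A) by rewrite inE.
have rowB j : el p j \in M -> j \in B.
  by move=> pj; apply/BP => i ji; apply/AP => /(_ j ji); rewrite pj.
have colA i : el i q \in M -> i \in A.
  move=> iq; apply/AP => j ji; apply: contra pq => pj.
  by rewrite -(lay_near H p q ji) Mmul.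
exists I.
  rewrite !inE -orbA; apply/orP; left; apply/andP; split.
    apply/maximal_independentP; split=> [j|i].
      by rewrite Il; split=> [/BP h i ji|h]; [rewrite Ir; apply: h | apply/BP => i /h; rewrite Ir].
    rewrite Ir; split=> [iA j ji|h].
      by rewrite Il; apply/BP => /(_ i ji); rewrite iA.
    by apply/AP => j /h; rewrite Il; apply: contra; apply: rowB.
  rewrite negb_or; apply/andP; split.
    have := cM q; rewrite negb_forall => /existsP [i]; rewrite negbK => /colA iA.
    by apply: contraTneq iA => IE; rewrite -Ir IE in_all_inl.
  have := rM p; rewrite negb_forall => /existsP [j]; rewrite negbK => /rowB jB.
  by apply: contraTneq jB => IE; rewrite -Il IE in_all_inr.
apply: sub => i j ijM; rewrite Il Ir; case: (boolP (i \in A)) => iA; first by rewrite orbT.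
have /existsP [c] : [exists c, near c i && (el p c \in M)].
  apply: contraR iA; rewrite negb_exists => /forallP h; apply/AP => c ci.
  by have := h c; rewrite ci.
by case/andP => ci pc; rewrite orbF; apply: rowB; rewrite -(lay_near H p j ci) Mmul.
Qed.

Lemma maximal_subsemigroupP M : 0 < m ->
  maximal_subsemigroup mul S M <-> M = S :\ e \/ exists2 I, I \in crit & M = sub_of I.
Proof.
move=> m0; split=> [mM|[->|[I /crit_saturated sI ->]]]; last 2 first.
- exact: minus_e_maximal.
- exact: sub_of_maximal.
have /maxsetP [pM mx] := mM; case: (boolP (e \in M)) => eM.
  have [I Ic MI] := proper_sub_crit pM eM; right; exists I => //.
  by rewrite -(mx _ _ MI) //; apply/sub_of_proper/crit_saturated.
have /maxsetP [pe _] := minus_e_maximal m0; left; rewrite -(mx _ pe) //.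
apply/subsetP => a aM; have /andP [/proper_sub/subsetP MS _] := pM.
by rewrite !inE (MS _ aM) andbT; apply: contraNneq eM => <-.
Qed.

Lemma sub_of_c l : sub_of (all_inl :\ inl l) = S :\: Llay l.
Proof.
apply/setP => a; case: (boolP (a \in layer)) => [/layerP [i [j ->]]|aJ].
  rewrite el_sub_of [RHS]inE mem_Llay (lay_elS H) !inE in_all_inl in_all_inl /= !andbT orbF.
  by [].
rewrite [RHS]inE; have -> : a \in Llay l = false.
  by apply: contraNF aJ; apply: (subsetP (Llay_sub l)).
case: (boolP (a \in S)) => aS; first exact: sub_of_out.
by apply/negbTE; apply: contra aS; apply: (subsetP (sub_of_sub _)).
Qed.

Lemma sub_of_d i : sub_of (all_inr :\ inr i) = S :\: Rlay i.
Proof.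
apply/setP => a; case: (boolP (a \in layer)) => [/layerP [k [j ->]]|aJ].
  by rewrite el_sub_of [RHS]inE mem_Rlay (lay_elS H) !inE in_all_inr in_all_inr /= !andbT.
rewrite [RHS]inE; have -> : a \in Rlay i = false.
  by apply: contraNF aJ; apply: (subsetP (Rlay_sub i)).
case: (boolP (a \in S)) => aS; first exact: sub_of_out.
by apply/negbTE; apply: contra aS; apply: (subsetP (sub_of_sub _)).
Qed.

Lemma card_crit : 1 < m -> #|crit| = #|crit_b| + m + m.
Proof.
move=> m1.
have cc : #|crit_c| = m.
  rewrite card_imset ?card_ord // => i j /setP /(_ (inl i)).
  by rewrite !inE eqxx in_all_inl /= andbT => /esym /negbFE /eqP [].
have cd : #|crit_d| = m.
  rewrite card_imset ?card_ord // => i j /setP /(_ (inr i)).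
  by rewrite !inE eqxx in_all_inr /= andbT => /esym /negbFE /eqP [].
have nmx : forall I, I \in crit_c :|: crit_d -> ~~ maximal_independent near_graph I.
  move=> I; rewrite inE => /orP [] /imsetP [i _ ->]; apply/negP => /maximal_independentP [HL HR].
    have /HL : forall k, near i k -> inr k \notin all_inl :\ inl i by move=> k _; rewrite !inE in_all_inl.
    by rewrite !inE eqxx.
  have /HR : forall k, near k i -> inl k \notin all_inr :\ inr i by move=> k _; rewrite !inE in_all_inr.
  by rewrite !inE eqxx.
rewrite /crit cardsU cardsU cc cd.
have -> : crit_b :&: crit_c = set0.
  apply/setP => I; rewrite !inE; apply/negbTE/andP => -[/andP [mI _] Ic].
  by have := nmx I; rewrite inE Ic mI => /(_ isT).
have -> : (crit_b :|: crit_c) :&: crit_d = set0.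
  apply/setP => I; rewrite !inE; apply/negbTE/andP => -[/orP [/andP [mI _]|/imsetP [i _ E]] Id].
    by have := nmx I; rewrite inE Id mI orbT => /(_ isT).
  have [j ji _] := near_other i.
  case/imsetP: Id E => k _ -> /setP /(_ (inl j)).
  by rewrite !inE in_all_inl in_all_inr /= andbT -[inl _ == _]/(j == i) ji.
by rewrite !cards0 !subn0.
Qed.

Lemma card_maximal : 1 < m ->
  #|[set M : {set T} | maximal_subsemigroup mul S M]| = #|crit_b| + 2 * m + 1.
Proof.
move=> m1; have -> : [set M : {set T} | maximal_subsemigroup mul S M] =
    (S :\ e) |: [set sub_of I | I in crit].
  apply/setP => M; rewrite inE; apply/idP/setU1P; rewrite maximal_subsemigroupP //; try exact: ltnW.
    by case=> [|[I Ic ->]]; [left | right; apply: imset_f].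
  by case=> [|/imsetP [I Ic ->]]; [left | right; exists I].
rewrite cardsU1 card_in_imset; last first.
  by move=> I I' /crit_saturated sI /crit_saturated sI'; apply: sub_of_inj.
rewrite card_crit //; have -> : S :\ e \notin [set sub_of I | I in crit].
  by apply/imsetP => -[I _ E]; have := e_sub_of I; rewrite -E !inE eqxx.
lia.
Qed.

(** * Types of the maximal subsemigroups *)

Lemma minus_e_type : type_M1 mul S (S :\ e).
Proof.
exists [set e]; split.
  by apply: e_arises; apply/subsetP => a; rewrite !inE; case: eqP => //=; case: (a \in S).
by apply/setP => a; rewrite !inE; case: (a == e); rewrite ?andbF.
Qed.

Lemma sub_of_arises I : 0 < m -> arises_from_regular mul S (sub_of I) layer.
Proof.
move=> m0; apply: layer_arises => //; apply/subsetP => a; rewrite inE => /andP [aI aS].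
by apply: contraNT aI; apply: sub_of_out.
Qed.

Lemma sub_of_layer I : sub_of I :&: layer =
  cover [set Llay j | j : 'I_m & inl j \in I] :|: cover [set Rlay i | i : 'I_m & inr i \in I].
Proof.
apply/setP => a; apply/setIP/setUP => [[aI /layerP [i [j E]]]|].
  move: aI; rewrite E el_sub_of => /orP [jI|iI]; [left|right]; apply/bigcupP.
    by exists (Llay j); rewrite ?mem_Llay //; apply/imsetP; exists j; rewrite ?inE.
  by exists (Rlay i); rewrite ?mem_Rlay //; apply/imsetP; exists i; rewrite ?inE.
case=> /bigcupP [X /imsetP [k]]; rewrite inE => kI -> /imsetP [l _ ->].
  by rewrite el_sub_of kI el_layer.
by rewrite el_sub_of kI el_layer orbT.
Qed.

End Layered.

Section LayeredTypes.
Context (T : finType) (mul : T -> T -> T) (S : {set T}) (e : T).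
Context (K : {set T}) (m : nat) (near : rel 'I_m) (el : 'I_m -> 'I_m -> T).
Context (H : layered mul S e K near el).
Implicit Types (a b c : T) (i j k l : 'I_m) (M : {set T}) (I : {set 'I_m + 'I_m}).
Let H' := layered_dual H.

Lemma Rlay_class i : Rlay el i \in R_classes mul S.
Proof. exact: (Llay_class H' i). Qed.

Lemma R_class_layer R i j : R \in R_classes mul S -> el i j \in R -> R = Rlay el i.
Proof. exact: (@L_class_layer _ _ _ _ _ _ _ _ H' R j i). Qed.

Lemma Llay_in j : Llay el j \in L_classes_in mul S (layer el).
Proof. by rewrite inE (Llay_class H) Llay_sub. Qed.

Lemma Rlay_in i : Rlay el i \in R_classes_in mul S (layer el).
Proof. by rewrite inE Rlay_class Rlay_sub. Qed.

Lemma Llay_inj : injective (Llay el).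
Proof. by move=> i j E; apply/eqP; rewrite -(mem_Llay H i i j) -E (mem_Llay H) eqxx. Qed.

Lemma Rlay_inj : injective (Rlay el).
Proof. by move=> i j E; apply/eqP; rewrite -(mem_Rlay H i i j) -E (mem_Rlay H) eqxx. Qed.

Lemma sub_of_meets I v : v \in I -> sub_of S el I :&: layer el != set0.
Proof.
move=> vI; apply/set0Pn; case: v vI => i vI; exists (el i i);
  by rewrite inE (el_sub_of H) vI ?orbT el_layer.
Qed.

Lemma crit_b_type I : I \in crit_b near -> type_M2 mul S (sub_of S el I).
Proof.
move=> Ib; have sI := crit_b_saturated H Ib.
have [i0 i0I] := sat_r sI; have [j0 j0I] := sat_l sI.
have m0 : 0 < m by case: i0 {i0I} => i; case: m.
have [j1 j1I] : exists j, inl j \in I.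
  case: (sat_near_r sI i0I) => [[b bI _]|]; first by exists b.
  move: Ib; rewrite inE => /andP [/maximal_independentP [_ HR] _] _.
  case: (boolP [exists j, inl j \in I]) => [/existsP //|]; rewrite negb_exists => /forallP h.
  by case/negP: i0I; apply/HR.
have [i1 i1I] : exists i, inr i \in I.
  case: (sat_near_l sI j0I) => [[b bI _]|]; first by exists b.
  move: Ib; rewrite inE => /andP [/maximal_independentP [HL _] _] _.
  case: (boolP [exists j, inr j \in I]) => [/existsP //|]; rewrite negb_exists => /forallP h.
  by case/negP: j0I; apply/HL.
exists (layer el); split; first exact: (sub_of_arises H).
split; first exact: sub_of_meets j1I.
exists [set Llay el j | j : 'I_m & inl j \in I], [set Rlay el i | i : 'I_m & inr i \in I].
split; last exact: (sub_of_layer H).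
- by apply/set0Pn; exists (Llay el j1); apply: imset_f; rewrite inE.
- apply/properP; split; first by apply/subsetP => X /imsetP [j _ ->]; apply: Llay_in.
  by exists (Llay el j0); rewrite ?Llay_in // mem_imset ?inE //; apply: Llay_inj.
- by apply/set0Pn; exists (Rlay el i1); apply: imset_f; rewrite inE.
apply/properP; split; first by apply/subsetP => X /imsetP [j _ ->]; apply: Rlay_in.
by exists (Rlay el i0); rewrite ?Rlay_in // mem_imset ?inE //; apply: Rlay_inj.
Qed.

Lemma crit_c_type l : 1 < m -> type_M3 mul S (S :\: Llay el l).
Proof.
move=> m1; have [j jl] : exists j : 'I_m, j != l.
  case: (eqVneq (val l) 0) => [l0|l0].
    by exists (Ordinal m1); rewrite -(inj_eq val_inj) /= l0.
  by exists (Ordinal (ltnW m1)); rewrite -(inj_eq val_inj) /= eq_sym.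
rewrite -(sub_of_c H); exists (layer el); split; first exact: (sub_of_arises H _ (ltnW m1)).
split; first by apply: (@sub_of_meets _ (inl j)); rewrite !inE in_all_inl andbT.
exists [set Llay el j | j : 'I_m & inl j \in all_inl m :\ inl l].
  by apply/subsetP => X /imsetP [k _ ->]; apply: Llay_in.
rewrite (sub_of_layer H); set X := cover [set Rlay _ _ | _ : _ & _].
have -> : X = set0; last by rewrite setU0.
apply/setP => a; rewrite !inE; apply/negbTE/bigcupP => -[Y /imsetP [k]].
by rewrite !inE in_all_inl.
Qed.

Lemma crit_d_type i : 1 < m -> type_M4 mul S (S :\: Rlay el i).
Proof.
move=> m1; have [j jl] : exists j : 'I_m, j != i.
  case: (eqVneq (val i) 0) => [l0|l0].
    by exists (Ordinal m1); rewrite -(inj_eq val_inj) /= l0.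
  by exists (Ordinal (ltnW m1)); rewrite -(inj_eq val_inj) /= eq_sym.
rewrite -(sub_of_d H); exists (layer el); split; first exact: (sub_of_arises H _ (ltnW m1)).
split; first by apply: (@sub_of_meets _ (inr j)); rewrite !inE in_all_inr andbT.
exists [set Rlay el j | j : 'I_m & inr j \in all_inr m :\ inr i].
  by apply/subsetP => X /imsetP [k _ ->]; apply: Rlay_in.
rewrite (sub_of_layer H); set X := cover [set Llay _ _ | _ : _ & _].
have -> : X = set0; last by rewrite set0U.
apply/setP => a; rewrite !inE; apply/negbTE/bigcupP => -[Y /imsetP [k]].
by rewrite !inE in_all_inr.
Qed.

End LayeredTypes.

(** * Counting the maximal independent sets *)

(** The words of length [k] starting with [Some b] that encode maximal
    independent sets: blocks of equal letters, separated by single letters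
    [None], at which the letter changes. *)
Fixpoint words (k : nat) (b : bool) : seq (seq (option bool)) :=
  match k with
  | 0 => [::]
  | (k'.+1 as k1).+1 =>
      [seq Some b :: w | w <- words k1 b] ++
      [seq [:: Some b, None & w] | w <- words k' (~~ b)]
  | 1 => [:: [:: Some b]]
  end.

Lemma size_words k b : size (words k b) = fib k.
Proof.
suff : forall c, size (words k c) = fib k /\ size (words k.+1 c) = fib k.+1 by case/(_ b).
elim: k {b} => [|k IH] c //; split; first by case: (IH c).
by rewrite [LHS]size_cat !size_map; case: (IH c) (IH (~~ c)) => _ -> [-> _].
Qed.

(** The local condition at position [i]: different letters other than [None] are
    not adjacent, and [None] only occurs between different letters. The default
    value [None] beyond the end of [w] excludes [None] as last letter. *)
Definition letter_ok (w : seq (option bool)) (i : nat) : bool :=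
  match nth None w i with
  | Some b => nth None w i.+1 != Some (~~ b)
  | None => (0 < i) && [exists b : bool,
      (nth None w i.-1 == Some b) && (nth None w i.+1 == Some (~~ b))]
  end.

Lemma wordsP k b w : w \in words k b <->
  [/\ size w = k, nth None w 0 = Some b & forall i, i < k -> letter_ok w i].
Proof.
have ok1 x u c i : nth None u 0 = Some c -> letter_ok (x :: u) i.+1 = letter_ok u i.
  by case: i => // u0; rewrite /letter_ok /= u0.
suff main : forall b w, (w \in words k b <->
     [/\ size w = k, nth None w 0 = Some b & forall i, i < k -> letter_ok w i]) /\
   (w \in words k.+1 b <->
     [/\ size w = k.+1, nth None w 0 = Some b & forall i, i < k.+1 -> letter_ok w i]).
  by case: (main b w).
elim: k {b w} => [|k IH] b w; split.
- by split=> // -[/size0nil ->].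
- split=> [|[]]; first by rewrite inE => /eqP ->; split=> // -[].
  by case: w => [|x []] //= _ -> _; rewrite inE.
- exact: (proj2 (IH b w)).
change (w \in words k.+2 b) with (w \in [seq Some b :: w | w <- words k.+1 b] ++
      [seq [:: Some b, None & w] | w <- words k (~~ b)]).
rewrite mem_cat; split.
  case/orP=> /mapP [u uw ->].
    have [su u0 ou] := (proj1 (proj2 (IH b u)) uw).
    split; rewrite /= ?su // => -[|i] ik; last by rewrite (ok1 _ _ _ _ u0) ou.
    by rewrite /letter_ok /= u0; case: (b).
  have [su u0 ou] := (proj1 (proj1 (IH (~~ b) u)) uw).
  split; rewrite /= ?su // => -[|[|i]] ik //.
    by apply/existsP; exists b; rewrite /= u0 !eqxx.
  by rewrite -[letter_ok _ _]/(letter_ok (None :: u) i.+1) (ok1 _ _ _ _ u0) ou.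
case; case: w => [|x [|y w]] //= [sw] -> ow; apply/orP.
case: y ow => [c|] ow; [left | right]; apply/mapP.
  have cb : c = b by have := ow 0 isT; rewrite /letter_ok /=; case: (b); case: (c).
  exists (Some c :: w); last by rewrite cb.
  apply: (proj2 (proj2 (IH b _))); split; rewrite /= ?sw ?cb // => i ik.
  by rewrite -(ok1 (Some b) _ c) ?cb // -{2}cb; apply: ow.
have w0 : nth None w 0 = Some (~~ b).
  by have := ow 1 isT; rewrite /letter_ok /= => /existsP [c /andP [/eqP [->] /eqP]].
exists w => //; apply: (proj2 (proj1 (IH _ _))); split=> // i ik.
have := ow i.+2 ik.
by rewrite -[letter_ok _ _]/(letter_ok (None :: w) i.+1) (ok1 _ _ _ _ w0).
Qed.

Lemma words_uniq k b : uniq (words k b).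
Proof.
suff : forall c, uniq (words k c) && uniq (words k.+1 c) by move/(_ b)/andP => [].
elim: k {b} => [|k IH] c //; have /andP [_ u1] := IH c; have /andP [u0 _] := IH (~~ c).
rewrite u1 /=; change (uniq ([seq Some c :: w | w <- words k.+1 c] ++
      [seq [:: Some c, None & w] | w <- words k (~~ c)])).
rewrite cat_uniq !map_inj_uniq; [|by move=> ? ? []..].
rewrite u1 u0 /= andbT; apply/hasPn => _ /mapP [w _ ->]; apply/mapP => -[u uw [E]].
by have [_] := proj1 (wordsP k.+1 c u) uw; rewrite -E.
Qed.

Section Count.
Variables (m : nat) (m0 : 0 < m).
Implicit Types (i j k : 'I_m) (I : {set 'I_m + 'I_m}).

Let mgraph := near_graph (@near m).

(** The vertex encoded by the letter [Some b] at position [i]. *)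
Definition vtx (b : bool) i : 'I_m + 'I_m := if b then inl i else inr i.

(** The letter of [I] at [i] tells which of the two vertices at [i] is in [I];
    the independent set is encoded by the word of its letters. *)
Definition letter I i : option bool :=
  if inl i \in I then Some true else if inr i \in I then Some false else None.

Definition code I : seq (option bool) := [seq letter I i | i <- enum 'I_m].

Lemma size_code I : size (code I) = m.
Proof. by rewrite size_map size_enum_ord. Qed.

Lemma nth_code I i : nth None (code I) i = letter I i.
Proof. by rewrite (nth_map i) ?size_enum_ord // nth_ord_enum. Qed.

Lemma near_refl_ord i : near i i. Proof. by rewrite /near leqnSn. Qed.

Lemma near_sym_ord i j : near i j = near j i. Proof. by rewrite /near andbC. Qed.

(** The characterization of maximal independent sets, uniformly in both sides. *)
Lemma mis_vtx I : maximal_independent mgraph I <->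
  forall b i, vtx b i \in I <-> forall k, near i k -> vtx (~~ b) k \notin I.
Proof.
rewrite maximal_independentP; split=> [[HL HR] [] i /=|h]; first exact: HL.
  by rewrite HR; split=> E k ik; apply: E; rewrite near_sym_ord.
split=> i; first exact: (h true).
by rewrite (h false); split=> E k ik; apply: E; rewrite near_sym_ord.
Qed.

Lemma mis_letter I b i : maximal_independent mgraph I ->
  (nth None (code I) i == Some b) = (vtx b i \in I).
Proof.
move/mis_vtx => h; rewrite nth_code /letter.
have := h true i; rewrite /=; case: (boolP (inl i \in I)) => iI.
  case=> /(_ isT i (near_refl_ord i)) iI' _.
  by case: b => /=; rewrite ?iI ?(negbTE iI').
by case: (boolP (inr i \in I)) => iI' _; case: b => /=; rewrite ?(negbTE iI) ?iI' ?(negbTE iI').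
Qed.

(** A word is locally correct when its letters satisfy the conditions defining a
    maximal independent set. *)
Lemma letter_okP w : size w = m ->
  (forall k : nat, k < m -> letter_ok w k) <->
  (forall b i, nth None w i == Some b <-> forall k, near i k -> nth None w k != Some (~~ b)).
Proof.
move=> sw.
have inw (k : nat) c : nth None w k = Some c -> k < m.
  by move=> E; rewrite -sw ltnNge; apply/negP => /(nth_default None); rewrite E.
split=> [ok b i|h k km].
  split=> [/eqP wi k|h].
    move=> ik; have := ok _ (ltn_ord i); have := ok _ (ltn_ord k); rewrite /letter_ok wi.
    have [->|ki] := eqVneq k i; first by rewrite wi; case: (b).
    have [E _ h|nE] := eqVneq (val k) i.+1; first by rewrite -[nat_of_ord k]/(val k) E.
    have E : val i = k.+1.
      by move: ik ki nE; rewrite /near -(inj_eq val_inj) /=; lia.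
    case Ek: (nth None w k) => [c|//].
    rewrite -E -[\val i]/(nat_of_ord i) wi => h _; apply: contraNneq h => -[->].
    by rewrite negbK.
  have := ok _ (ltn_ord i); rewrite /letter_ok; case Ei: (nth None w i) => [c|].
    have := h i (near_refl_ord i); rewrite Ei.
    by case: (b); case: (c).
  case/andP => i0 /existsP [c /andP [/eqP E1 /eqP E2]].
  have [cb|cb] := eqVneq c b.
    have nr : near i (Ordinal (inw _ _ E2)) by rewrite /near /=; lia.
    by have := h _ nr; rewrite /= E2 cb eqxx.
  have nr : near i (Ordinal (inw _ _ E1)) by rewrite /near /=; lia.
  have := h _ nr; rewrite /= E1.
  by have -> : c = ~~ b by [case: (b) (c) cb => [] []]; rewrite eqxx.
pose i := Ordinal km; rewrite /letter_ok; case Ek: (nth None w k) => [b|].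
  case: (boolP (k.+1 < m)) => k1m; last by rewrite nth_default // sw leqNgt.
  have /h := introT eqP (Ek : nth None w i = Some b).
  by move/(_ (Ordinal k1m)); apply; rewrite /near /=; lia.
have nb b : exists2 j : 'I_m, near i j & nth None w j == Some (~~ b).
  apply/exists_inP; apply: contraT; rewrite negb_exists_in => /forall_inP nh.
  by have /h : forall j, near i j -> nth None w j != Some (~~ b) by []; rewrite Ek.
have [j1 n1 /eqP E1] := nb false; have [j2 n2 /eqP E2] := nb true.
have d1 : j1 <> k :> nat by move=> E; rewrite E Ek in E1.
have d2 : j2 <> k :> nat by move=> E; rewrite E Ek in E2.
have d3 : j1 <> j2 :> nat by move=> E; rewrite E E2 in E1.
move: n1 n2; rewrite /near /= => n1 n2; apply/andP; split; first by lia.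
apply/existsP; have [E|nE] := eqVneq (val j1) k.+1.
  exists false; have <- : nat_of_ord j2 = k.-1 by move: E; rewrite /=; lia.
  by rewrite E2 -E /= E1.
exists true; have <- : nat_of_ord j1 = k.-1 by move: nE; rewrite /=; lia.
by have <- : nat_of_ord j2 = k.+1 by [move: nE; rewrite /=; lia]; rewrite E2 E1.
Qed.

Lemma card_mis : #|[set I | maximal_independent mgraph I]| = 2 * fib m.
Proof.
set X := [set I | _].
rewrite cardE -(size_map code).
have -> : 2 * fib m = size (words m true ++ words m false).
  by rewrite size_cat !size_words mul2n addnn.
apply/perm_size/uniq_perm.
- rewrite map_inj_in_uniq ?enum_uniq // => I I'; rewrite !mem_enum !inE => mI mI' E.
  by apply/setP => -[i|i]; [rewrite -(mis_letter true i mI) E (mis_letter true i mI')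
    | rewrite -(mis_letter false i mI) E (mis_letter false i mI')].
- rewrite cat_uniq !words_uniq /= andbT; apply/hasPn => w /wordsP [_ E _].
  by apply/negP => /wordsP [_]; rewrite E.
move=> w; rewrite mem_cat; apply/mapP/idP => [[I]|].
  rewrite mem_enum inE => mI ->.
  have ok : forall k : nat, k < m -> letter_ok (code I) k.
    apply/letter_okP; first exact: size_code.
    move=> b i; rewrite (mis_letter b i mI); move/mis_vtx: (mI) => ->.
    by split=> h k ik; [rewrite (mis_letter _ _ mI) | rewrite -(mis_letter _ _ mI)]; apply: h.
  have [c E] : exists c, nth None (code I) 0 = Some c.
    by have := ok 0 m0; rewrite /letter_ok; case: nth => // c; exists c.
  have cw : code I \in words m c by apply/wordsP; split=> //; apply: size_code.
  by case: c cw {E} => ->; rewrite ?orbT.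
move=> ww; have [c /wordsP [sw _ ow]] : exists c, w \in words m c.
  by case/orP: ww; [exists true | exists false].
pose I : {set 'I_m + 'I_m} :=
  [set v : 'I_m + 'I_m |
    match v with inl i => nth None w i == Some true | inr i => nth None w i == Some false end].
have vI b i : (vtx b i \in I) = (nth None w i == Some b) by case: b; rewrite inE.
have mI : maximal_independent mgraph I.
  apply/mis_vtx => b i; rewrite vI; move/letter_okP: ow => -> //.
  by split=> h k ik; [rewrite vI | rewrite -vI]; apply: h.
exists I; first by rewrite mem_enum inE.
apply: (@eq_from_nth _ None); first by rewrite size_code.
move=> k; rewrite sw => km; rewrite -[k]/(nat_of_ord (Ordinal km)).
case E: (nth None w (Ordinal km)) => [b|].
  by apply/esym/eqP; rewrite mis_letter // vI E.
case E': (nth None (code I) _) => [b|//].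
by move/eqP: E'; rewrite mis_letter // vI E.
Qed.

Lemma card_crit_b : #|crit_b (@near m)| = 2 * fib m - 2.
Proof.
have mL : all_inl m \in [set I | maximal_independent mgraph I].
  rewrite inE; apply/maximal_independentP; split=> i; rewrite in_all_inl; split=> //.
    by move=> _ k _; rewrite in_all_inl.
  by move/(_ i (near_refl_ord i)); rewrite in_all_inl.
have mR : all_inr m \in [set I | maximal_independent mgraph I].
  rewrite inE; apply/maximal_independentP; split=> i; rewrite in_all_inr; split=> //.
    by move/(_ i (near_refl_ord i)); rewrite in_all_inr.
  by move=> _ k _; rewrite in_all_inr.
have RL : all_inr m != all_inl m.
  apply/eqP => /setP /(_ (inl (Ordinal m0))); by rewrite in_all_inl in_all_inr.
have -> : crit_b (@near m) = [set I | maximal_independent mgraph I] :\ all_inl m :\ all_inr m.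
  by apply/setP => I; rewrite !inE negb_or andbC -andbA andbCA.
have := cardsD1 (all_inl m) [set I | maximal_independent mgraph I].
have := cardsD1 (all_inr m) ([set I | maximal_independent mgraph I] :\ all_inl m).
by rewrite mL in_setD1 RL mR card_mis /= => -> ->; rewrite addnA addKn.
Qed.

End Count.

(** * The Jones monoid *)

Section JonesMonoid.
Variables (n : nat) (n2 : 2 <= n).
Implicit Types (a b : dpart n) (M : {set dpart n}) (i j : 'I_n.-1).

(** The ideal below the layer of rank [n - 2]. *)
Definition low_rank : {set dpart n} := [set a in Jones n | rank a < n - 2].

Lemma Jones_layered :
  layered (@dmul n) (Jones n) (did n) low_rank (@near n.-1) (@el n).
Proof.
have inK a : (a \in low_rank) = (a \in Jones n) && (rank a < n - 2) by rewrite inE.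
have did_rank a : a \in Jones n -> n <= rank a -> a = did n.
  move=> aJ na; apply/eqP; apply: contraTT na => /(rank_lt aJ); lia.
split=> //.
- exact: dmul_Jones.
- exact: dmulA.
- exact: dmul1.
- exact: dmul_1.
- exact: did_Jones.
- exact: el_Jones.
- by apply/subsetP => a; rewrite inK => /andP [].
- move=> a aJ; have [->|ad] := eqVneq a (did n); first by constructor 1.
  case: (ltngtP (rank a) (n - 2)) => ra; last by constructor 2; apply: exists_el.
    by constructor 3; rewrite inK aJ.
  by have := rank_lt aJ ad; lia.
- by move=> i j; apply/eqP => E; have := rank_el i j; rewrite E rank_did; lia.
- by rewrite inK rank_did; lia.
- by move=> i j; rewrite inK rank_el ltnn andbF.
- exact: el_inj.
- move=> a b aJ bJ E; split; apply: did_rank => //.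
    by rewrite -{1}(rank_did n) -E rank_mull.
  by rewrite -{1}(rank_did n) -E rank_mulr.
- move=> a b aJ; rewrite !inK => /andP [bJ rb]; rewrite dmul_Jones //=.
  exact: leq_ltn_trans (rank_mulr aJ bJ) rb.
- move=> a b; rewrite !inK => /andP [aJ ra] bJ; rewrite dmul_Jones //=.
  exact: leq_ltn_trans (rank_mull aJ bJ) ra.
- by move=> *; apply: el_mul.
- by move=> i j k l jk; rewrite inK dmul_Jones ?el_Jones //= el_mul_low.
- move=> M MM eM elM; apply/subsetP => a aJ; elim/Jones_hookd_ind: a / aJ => // i b _ bM.
  by apply: MM => //; rewrite hookd_el.
- exact: near_refl_ord.
exact: near_sym_ord.
Qed.

Let H := Jones_layered.

Lemma mem_layer a : (a \in layer (@el n)) = (a \in Jones n) && (rank a == n - 2).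
Proof.
apply/layerP/andP => [[i [j ->]]|[aJ /eqP ra]]; first by rewrite el_Jones rank_el.
exact: exists_el.
Qed.

Lemma Lcl_lay j : Lcl j = Llay (@el n) j.
Proof.
apply/setP => a; rewrite LclE; apply/and3P/imsetP => [[aJ /eqP ra aj]|[i _ ->]].
  have [i [k E]] := exists_el n2 aJ ra; exists i => //; rewrite E in aj *.
  by move: aj; rewrite lhook_el_eq => /eqP ->.
by rewrite el_Jones rank_el lhook_el.
Qed.

Lemma Rcl_lay i : Rcl i = Rlay (@el n) i.
Proof.
apply/setP => a; rewrite RclE; apply/and3P/imsetP => [[aJ /eqP ra aj]|[j _ ->]].
  have [k [j E]] := exists_el n2 aJ ra; exists j => //; rewrite E in aj *.
  by move: aj; rewrite uhook_el_eq => /eqP ->.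
by rewrite el_Jones rank_el uhook_el.
Qed.

Lemma Delta_near : @Delta n =2 near_graph (@near n.-1).
Proof. by case=> [i|i] [j|j] //=; rewrite Lcl_lay Rcl_lay (is_group_layer H). Qed.

Lemma maximal_independent_Delta (I : {set vertex n}) :
  maximal_independent (@Delta n) I = maximal_independent (near_graph (@near n.-1)) I.
Proof.
have ind J : independent (@Delta n) J = independent (near_graph (@near n.-1)) J.
  by apply: eq_forallb_in => u uJ; apply: eq_forallb_in => v vJ; rewrite Delta_near.
by apply/maxsetP/maxsetP => -[IJ mx]; (split; first by rewrite ?ind // -ind) => B;
  rewrite -?ind => BJ; apply: mx; rewrite ?ind // -ind.
Qed.

Lemma sub_ofE (I : {set vertex n}) :
  [set a in Jones n | rank a != n - 2] :|: \bigcup_(v in I) vclass v =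
  sub_of (Jones n) (@el n) I.
Proof.
congr (_ :|: _).
  by apply/setP => a; rewrite inE [RHS]inE mem_layer andbC; case: (a \in Jones n); rewrite ?andbF.
by apply: eq_bigr => -[i|i] _; rewrite /= ?Lcl_lay ?Rcl_lay.
Qed.

Lemma family_bE M : family_b M <->
  exists2 I, I \in crit_b (@near n.-1) & M = sub_of (Jones n) (@el n) I.
Proof.
split=> [[I [mI nI ->]]|[I]]; last first.
  rewrite inE => /andP [mI nI] ->; exists I; split=> //.
    by rewrite maximal_independent_Delta.
  by rewrite sub_ofE.
exists I; last exact: sub_ofE.
by rewrite inE -maximal_independent_Delta mI.
Qed.

Lemma family_cE M : family_c M <-> exists l, M = Jones n :\: Llay (@el n) l.
Proof.
split=> [[L [Lc /forall_inP rL ->]]|[l ->]].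
  have /imsetP [a aJ EL] := Lc.
  have aL : a \in L by rewrite EL inE aJ /greenL eqxx.
  have [i [j E]] := exists_el n2 aJ (eqP (rL _ aL)).
  by exists j; rewrite E in aL; rewrite (L_class_layer H Lc aL).
exists (Llay (@el n) l); split=> //; first exact: (Llay_class H).
by apply/forall_inP => a /imsetP [i _ ->]; rewrite rank_el.
Qed.

Lemma family_dE M : family_d M <-> exists i, M = Jones n :\: Rlay (@el n) i.
Proof.
split=> [[R [Rc /forall_inP rR ->]]|[i ->]].
  have /imsetP [a aJ ER] := Rc.
  have aR : a \in R by rewrite ER inE aJ /greenR eqxx.
  have [i [j E]] := exists_el n2 aJ (eqP (rR _ aR)).
  by exists i; rewrite E in aR; rewrite (R_class_layer H Rc aR).
exists (Rlay (@el n) i); split=> //; first exact: (Rlay_class H).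
by apply/forall_inP => a /imsetP [j _ ->]; rewrite rank_el.
Qed.

End JonesMonoid.

Lemma near_other m (i : 'I_m) : 1 < m -> exists2 j : 'I_m, j != i & near j i.
Proof.
move=> m1; have h : (if val i == 0 then 1 else i.-1) < m.
  by case: ifP => // _; have := ltn_ord i; lia.
exists (Ordinal h); rewrite /near -?(inj_eq val_inj) /=; case: ifP; lia.
Qed.

Lemma Jones2_cases (a : dpart 2) : a \in Jones 2 -> a = did 2 \/ a = @hookd 2 ord0.
Proof.
move=> aJ; have [->|ad] := eqVneq a (did 2); first by left.
have ra : rank a = 2 - 2 by have := rank_lt aJ ad; lia.
have [i [j ->]] := exists_el (leqnn 2) aJ ra.
by right; rewrite hookd_el (ord1 i) (ord1 j).
Qed.

Theorem theorem4p8 :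
  (forall n : nat, 3 <= n ->
     [/\ forall M : {set dpart n},
           maximal_subsemigroup dmul (Jones n) M <->
             [\/ family_a M, family_b M, family_c M | family_d M],
         [/\ forall M : {set dpart n}, family_a M -> type_M1 dmul (Jones n) M,
             forall M : {set dpart n}, family_b M -> type_M2 dmul (Jones n) M,
             forall M : {set dpart n}, family_c M -> type_M3 dmul (Jones n) M
           & forall M : {set dpart n}, family_d M -> type_M4 dmul (Jones n) M]
       & #|[set M : {set dpart n} | maximal_subsemigroup dmul (Jones n) M]|
         = 2 * fib (n - 1) + 2 * n - 3])
  /\
  [/\ semilattice dmul (Jones 2),
      #|Jones 2| = 2
    & forall M : {set dpart 2},
        maximal_subsemigroup dmul (Jones 2) M <->
        exists2 al, al \in Jones 2 & M = [set al]].
Proof.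
split.
  move=> n n3; have n2 : 2 <= n by apply: ltnW.
  have m1 : 1 < n.-1 by lia.
  have H := Jones_layered n2; have no i := @near_other n.-1 i m1.
  split.
  - move=> M; rewrite (maximal_subsemigroupP H no M (ltnW m1)); split.
      case=> [->|[I /setUP [/setUP [Ib|/imsetP [l _ ->]]|/imsetP [l _ ->]] ->]].
      + by constructor 1.
      + by constructor 2; apply/family_bE => //; exists I.
      + by constructor 3; apply/family_cE => //; exists l; rewrite (sub_of_c H).
      + by constructor 4; apply/family_dE => //; exists l; rewrite (sub_of_d H).
    case=> [->|/(family_bE n2) [I Ib ->]|/(family_cE n2) [l ->]|/(family_dE n2) [l ->]].
    + by left.
    + by right; exists I => //; apply/setUP; left; apply/setUP; left.
    + right; exists (all_inl n.-1 :\ inl l); last by rewrite (sub_of_c H).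
      by apply/setUP; left; apply/setUP; right; apply: imset_f.
    right; exists (all_inr n.-1 :\ inr l); last by rewrite (sub_of_d H).
    by apply/setUP; right; apply: imset_f.
  - split=> M.
    + by move=> ->; apply: (minus_e_type H).
    + by case/(family_bE n2) => I Ib ->; apply: (crit_b_type H).
    + by case/(family_cE n2) => l ->; apply: (crit_c_type H).
    + by case/(family_dE n2) => l ->; apply: (crit_d_type H).
  rewrite (card_maximal H no m1) card_crit_b; last exact: ltnW.
  have f0 : forall k, 0 < k -> 0 < fib k.
    by case=> // k _; elim: k => // -[|k] // IH; rewrite [fib _]/(fib k.+2 + fib k.+1) addn_gt0 IH.
  have := f0 _ (ltnW m1); rewrite subn1; lia.
have d0 : did 2 != @hookd 2 ord0 .
  by apply/eqP => E; have := rank_did 2; rewrite E rank_hookd.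
have dJ := did_Jones 2; have hJ := @hookd_Jones 2 ord0.
have hh : dmul (@hookd 2 ord0) (@hookd 2 ord0) = @hookd 2 ord0.
  by apply: uhook_absorb => //; apply: uhook_hookd.
have JE : Jones 2 = [set did 2; @hookd 2 ord0].
  apply/setP => a; apply/idP/set2P => [aJ|[] -> //]; exact: Jones2_cases.
have idem a : a \in Jones 2 -> dmul a a = a.
  by case/Jones2_cases => ->; rewrite ?dmul1.
split.
- apply/and4P; split.
  + apply/andP; split; first by apply/set0Pn; exists (did 2).
    by apply/forall_inP => a aJ; apply/forall_inP => b bJ; apply: dmul_Jones.
  + by do 3!(apply/forall_inP => ? _); rewrite dmulA.
  + apply/forall_inP => a aJ; apply/forall_inP => b bJ.
    by case/Jones2_cases: aJ => ->; case/Jones2_cases: bJ => ->; rewrite ?dmul1 ?dmul_1.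
  by apply/forall_inP => a aJ; rewrite idem.
- by rewrite JE cards2 d0.
have single a : a \in Jones 2 -> proper_subsemigroup dmul (Jones 2) [set a].
  move=> aJ; apply/and3P; split.
  - by rewrite properEcard sub1set aJ cards1 JE cards2 d0.
  - by apply/set0Pn; exists a; rewrite inE.
  by apply/forall_inP => x /set1P ->; apply/forall_inP => y /set1P ->; rewrite idem // set11.
have small M : proper_subsemigroup dmul (Jones 2) M -> exists2 a, a \in Jones 2 & M = [set a].
  case/and3P => MJ M0 _; have /set0Pn [a aM] := M0.
  exists a; first exact: (subsetP (proper_sub MJ)).
  apply/eqP; rewrite eq_sym eqEcard sub1set aM cards1.
  by have := proper_card MJ; rewrite JE cards2 d0.
move=> M; split=> [/maxsetP [/small]|[a aJ ->]] //.
apply/maxsetP; split; first exact: single.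
by move=> B /small [b bJ ->]; rewrite sub1set => /set1P ->.
Qed.
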